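(* Let $p>1$ and $a,b,L>0$. Then: (I) The set $\Lambda^{a,b}_p(0,L)$ of Dirichlet eigenvalues of $-\Delta^{a,b}_p$ on $(0,L)$ is $$\Lambda^{a,b}_p(0,L)=\left\{\lambda^{a,b}_{k,p}(0,L):=\left(\frac{k(a+b)}{2}\right)^p\lambda_{1,p}(0,L):\ k\in\mathbb N\right\}=\left(\frac{a+b}{2}\right)^p\{\lambda_{k,p}(0,L):k\in\mathbb N\}.$$ (II) For $k\in\mathbb N$, a function $u\in W^{1,p}_0(0,L)$ is an eigenfunction of $-\Delta^{a,b}_p$ associated to $\lambda^{a,b}_{k,p}(0,L)$ if and only if either $u(t)=c\,\phi^{a,b}_p\!\left(\frac{kt}{L}\right)$ or $u(t)=c\,\phi^{a,b}_p\!\left(\frac{kt}{L}-1\right)$ for some constant $c>0$.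
   Context: For $p>1$, $a,b,L>0$, the asymmetric $p$-Laplacian $\Delta^{a,b}_p u=\big(a^p[(u')^+]^{p-1}-b^p[(u')^-]^{p-1}\big)'$ is understood weakly: $u\in W^{1,p}_0(0,L)$ is a weak solution of $-\Delta^{a,b}_p u=g$ in $(0,L)$ if $\int_0^L\big(a^p[(u')^+]^{p-1}-b^p[(u')^-]^{p-1}\big)\varphi'\,dt=\int_0^L g\varphi\,dt$ for all $\varphi\in W^{1,p}_0(0,L)$. Here $s^\pm=\max\{\pm s,0\}$. The Dirichlet spectrum is $\Lambda^{a,b}_p(0,L)=\{\lambda\in\mathbb R:$ the problem $-\Delta^{a,b}_p u=\lambda|u|^{p-2}u$ in $(0,L)$, $u(0)=u(L)=0$, has a nontrivial weak solution $u\in W^{1,p}_0(0,L)\}$; such $u$ are the eigenfunctions associated to $\lambda$. $\pi_p:=2\int_0^1(1-t^p)^{-1/p}dt$ and $\lambda_{k,p}(0,L):=(p-1)\left(\frac{k\pi_p}{L}\right)^p$ for $k\in\mathbb N$ (the Dirichlet eigenvalues of the classical $-\Delta_p u=-(|u'|^{p-2}u')'$ on $(0,L)$). $\varphi_p\in W^{1,p}_0(0,1)$ denotes the positive principal eigenfunction of $-\Delta_p$ on $(0,1)$ associated to $\lambda_{1,p}(0,1)$, normalized by $\|\varphi_p\|_{L^p}=1$. Let $t_0=\frac{a}{a+b}$. Define on $[0,1]$: $\varphi^{a,b,+}_p(t)=\varphi_p\!\left(\frac{t}{2t_0}\right)$ for $t\in[0,t_0)$, $\varphi^{a,b,+}_p(t)=\varphi_p\!\left(\frac{t+1-2t_0}{2(1-t_0)}\right)$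 for $t\in[t_0,1]$; $\varphi^{a,b,-}_p(t)=-\varphi_p\!\left(\frac{t}{2(1-t_0)}\right)$ for $t\in[0,1-t_0)$, $\varphi^{a,b,-}_p(t)=-\varphi_p\!\left(\frac{t+2t_0-1}{2t_0}\right)$ for $t\in[1-t_0,1]$. The $2$-periodic function $\phi^{a,b}_p:\mathbb R\to\mathbb R$ is defined by $\phi^{a,b}_p(t)=\varphi^{a,b,+}_p(t)$ for $t\in[0,1)$, $\phi^{a,b}_p(t)=\varphi^{a,b,-}_p(t-1)$ for $t\in[1,2]$, and $\phi^{a,b}_p(t+2)=\phi^{a,b}_p(t)$ for all $t\in\mathbb R$. *)

(* Defs.v *)
From HB Require Import structures.
From mathcomp Require Import all_boot all_order all_algebra.
From mathcomp Require Import all_classical all_reals all_analysis.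
Set Implicit Arguments. Unset Strict Implicit. Unset Printing Implicit Defensive.
Import Order.TTheory GRing.Theory Num.Theory.
Import numFieldNormedType.Exports.
Local Open Scope classical_set_scope.
Local Open Scope ring_scope.

Section Defs.
Variable R : realType.
Local Notation mu := (@lebesgue_measure R).

Definition pi_p (p : R) : R :=
  2 * \int[mu]_(t in `[0, 1]) ((1 - t `^ p) `^ (- p^-1)).

Definition lambda_kp (p : R) (k : nat) (L : R) : R :=
  (p - 1) * ((k%:R * pi_p p / L) `^ p).

Definition lambda_ab_kp (p a b : R) (k : nat) (L : R) : R :=
  ((k%:R * (a + b) / 2) `^ p) * lambda_kp p 1 L.

(* W^{1,p}_0(0,L), one-dimensional description: u is (on [0,L]) the
   primitive u(t) = int_0^t g of a function g in L^p(0,L) (its weak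
   derivative), and u(0) = u(L) = 0. *)
Definition W1p0 (p L : R) (u g : R -> R) : Prop :=
  [/\ mu.-integrable `[0, L] (EFin \o g),
      mu.-integrable `[0, L] (EFin \o (fun t => `|g t| `^ p)),
      (forall t, 0 <= t <= L -> u t = \int[mu]_(s in `[0, t]) g s)
    & u L = 0].

Definition pos_part (s : R) : R := Num.max s 0.
Definition neg_part (s : R) : R := Num.max (- s) 0.

Definition flux_ab (p a b s : R) : R :=
  a `^ p * (pos_part s) `^ (p - 1) - b `^ p * (neg_part s) `^ (p - 1).

Definition flux_p (p s : R) : R := `|s| `^ (p - 2) * s.

Definition rhs_p (p s : R) : R := `|s| `^ (p - 2) * s.

(* u in W^{1,p}_0(0,L) is a weak solution of -(F(u'))' = lam |u|^{p-2} u *)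
Definition weak_eigen_sol (F : R -> R) (p L lam : R) (u : R -> R) : Prop :=
  exists g, W1p0 p L u g /\
    forall phi psi, W1p0 p L phi psi ->
      \int[mu]_(t in `[0, L]) (F (g t) * psi t)
      = lam * \int[mu]_(t in `[0, L]) (rhs_p p (u t) * phi t).

Definition nontrivial (L : R) (u : R -> R) : Prop :=
  exists t, 0 <= t <= L /\ u t != 0.

Definition eigenfunction_ab (p a b L lam : R) (u : R -> R) : Prop :=
  weak_eigen_sol (flux_ab p a b) p L lam u /\ nontrivial L u.

Definition spectrum_ab (p a b L : R) : set R :=
  [set lam | exists u, eigenfunction_ab p a b L lam u].

Definition principal_eigenfunction_p (p : R) (phi : R -> R) : Prop :=
  [/\ weak_eigen_sol (flux_p p) p 1 (lambda_kp p 1 1) phi,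
      (forall t, 0 < t < 1 -> 0 < phi t)
    & \int[mu]_(t in `[0, 1]) (`|phi t| `^ p) = 1].

Definition t0 (a b : R) : R := a / (a + b).

Definition phi_ab_plus (phip : R -> R) (a b t : R) : R :=
  if t < t0 a b then phip (t / (2 * t0 a b))
  else phip ((t + 1 - 2 * t0 a b) / (2 * (1 - t0 a b))).

Definition phi_ab_minus (phip : R -> R) (a b t : R) : R :=
  if t < 1 - t0 a b then - phip (t / (2 * (1 - t0 a b)))
  else - phip ((t + 2 * t0 a b - 1) / (2 * t0 a b)).

Definition phi_ab (phip : R -> R) (a b t : R) : R :=
  let s := t - 2 * (Num.floor (t / 2))%:~R in
  if s < 1 then phi_ab_plus phip a b s else phi_ab_minus phip a b (s - 1).

End Defs.

(* Main.v *)
Require Import Defs.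
From HB Require Import structures.
From mathcomp Require Import all_boot all_order all_algebra.
From mathcomp Require Import ring lra.
From mathcomp Require Import all_classical all_reals all_analysis.
From mathcomp Require Import measurable_realfun.
Set Implicit Arguments. Unset Strict Implicit. Unset Printing Implicit Defensive.
Import Order.TTheory GRing.Theory Num.Theory.
Import numFieldNormedType.Exports.
Local Open Scope classical_set_scope.
Local Open Scope ring_scope.

(** Testing against bounded functions (du Bois-Reymond) and integrating by parts
    show that [u] is a weak solution exactly when, with [w] the flux of [u'],
    [(u, w)] is a classical solution of the planar Hamiltonian system
    [u' = G w], [w' = - lam |u|^(p-2) u], where [G], the inverse of the flux, is
    the flux of the conjugate exponent for [1/a, 1/b].  Although neither
    right-hand side is Lipschitz, the initial value problem has a unique
    solution: away from the equilibrium, conservation of energy expresses one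
    coordinate by the other and leaves a Gronwall inequality.  Uniqueness makes
    the principal eigenfunction symmetric about [1/2], so its two halves,
    rescaled in time, glue to a solution [phi_ab] on the whole line that vanishes
    exactly at the integers.  By homogeneity and uniqueness every nontrivial
    solution starting at [0] is [c phi_ab (k t)] or [c phi_ab (k t - 1)]; the
    condition at [L] makes [k L] an integer and fixes [lam].  The given
    principal eigenfunction replaces any computation of [pi_p]. *)

(** The two right-hand sides have exponents [1/(p-1)] and [p-1], so unless [p = 2] one of them is
    below [1] and Lipschitz continuity fails along a whole coordinate axis, not only at the origin.
    Uniqueness is therefore proved where [w > 0], using that the energy, unlike the flux, is always
    [C^1]. The symmetries [(u, w) -> (-u, -w)] and [(u, w) -> (w, -u)] carry this to every nonzero
    state, and at the origin zero energy persists. The constant [(a+b)/2] and the turning point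
    [t0 = a/(a+b)] arise together. Replacing the coefficient [1] by [a] where [u' >= 0] multiplies
    the eigenvalue by [a^p]; stretching that half from length [1/2] to [t0] divides it by
    [(2 t0)^p]. Since [a / (2 t0) = b / (2 (1 - t0)) = (a+b)/2], both halves get the same
    eigenvalue, and no other turning point achieves this. The value is symmetric in [a] and [b], so
    the negative half-wave, which exchanges them, shares it. *)

(** * Powers of the positive part; the flux, its primitive and its inverse *)

Section FluxCalculus.
Variable R : realType.
Implicit Types (p q r s t x a b : R).

Lemma pos_partE s : 0 <= s -> pos_part s = s.
Proof. by move=> s0; rewrite /pos_part max_l. Qed.

Lemma pos_part0 s : s <= 0 -> pos_part s = 0.
Proof. by move=> s0; rewrite /pos_part max_r. Qed.

Lemma pos_part_ge0 s : 0 <= pos_part s.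
Proof. by rewrite /pos_part le_max lexx orbT. Qed.

Lemma pos_part_le s : pos_part s <= `|s|.
Proof. by rewrite /pos_part ge_max ler_norm normr_ge0. Qed.

Lemma is_derive1_continuous (f : R -> R) x d :
  is_derive x 1 f d -> {for x, continuous f}.
Proof. by move=> [fx _]; apply/differentiable_continuous/derivable1_diffP. Qed.

(** Pointwise forms of the library rules: with explicit lambdas, the function and its derivative are
    both found by unification. *)
Lemma is_deriveDf (f g : R -> R) x d e : is_derive x 1 f d -> is_derive x 1 g e ->
  is_derive x 1 (fun y => f y + g y) (d + e).
Proof. exact: is_deriveD. Qed.

Lemma is_deriveNf (f : R -> R) x d : is_derive x 1 f d ->
  is_derive x 1 (fun y => - f y) (- d).
Proof. exact: is_deriveN. Qed.

Lemma is_deriveZf (f : R -> R) k x d : is_derive x 1 f d ->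
  is_derive x 1 (fun y => k * f y) (k * d).
Proof. exact: is_deriveZ. Qed.

Lemma is_deriveMf (f g : R -> R) x d e : is_derive x 1 f d -> is_derive x 1 g e ->
  is_derive x 1 (fun y => f y * g y) (f x * e + g x * d).
Proof. exact: is_deriveM. Qed.

Lemma is_derive1_compf (f g : R -> R) x d e :
  is_derive (g x) 1 f d -> is_derive x 1 g e ->
  is_derive x 1 (fun y => f (g y)) (d * e).
Proof. exact: is_derive1_comp. Qed.

Lemma is_derive_comp_affine (f : R -> R) c d x l :
  is_derive (c * x + d) 1 f l -> is_derive x 1 (fun y => f (c * y + d)) (c * l).
Proof.
move=> df; have da : is_derive x 1 (c *: id + cst d) c.
  by apply: is_derive_eq; rewrite addr0 /GRing.scale/= mulr1.
by have := @is_derive1_comp R f (c *: id + cst d) x l c df da; rewrite mulrC.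
Qed.

Lemma is_derive_comp_shift (f : R -> R) d x l :
  is_derive (x + d) 1 f l -> is_derive x 1 (fun y => f (y + d)) l.
Proof.
move=> df; have := @is_derive_comp_affine f 1 d x l; rewrite !mul1r => /(_ df).
by congr is_derive; apply/funext => y; rewrite mul1r.
Qed.

(** The range [0 < r < 1] matters, since [p - 1] may be below [1]. At the origin [pos_part y <= |y|]
    gives the modulus of continuity [e^(1/r)]. *)
Lemma continuous_pos_part_powR r :
  0 < r -> continuous (fun x => pos_part x `^ r).
Proof.
move=> r0 x; have [x0|x0|<-] := ltgtP 0 x.
- rewrite /continuous_at pos_partE ?ltW//.
  have c : {for x, continuous (fun y : R => y `^ r)}.
    by apply: is_derive1_continuous; apply: is_derive1_powR.
  apply: cvg_trans c; apply: near_eq_cvg; near=> y; rewrite pos_partE// ltW//.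
  by near: y; exact: lt_nbhsr.
- rewrite /continuous_at pos_part0 ?ltW//.
  apply: cvg_near_cst; near=> y; rewrite pos_part0// ltW//.
  by near: y; exact: lt_nbhsl.
- rewrite /continuous_at pos_part0// powR0 ?gt_eqF//.
  apply/cvgrPdist_lt => e e0.
  have e1 : 0 < e `^ r^-1 by apply: powR_gt0.
  near=> y.
  rewrite sub0r normrN ger0_norm ?powR_ge0//.
  have -> : e = (e `^ r^-1) `^ r by rewrite -powRrM mulVf ?gt_eqF// powRr1// ltW.
  apply: gt0_ltr_powR => //; rewrite ?nnegrE ?powR_ge0 ?pos_part_ge0//.
  apply: le_lt_trans (pos_part_le y) _.
  by near: y; exact: (@nbhs0_lt R R _ e1).
Unshelve. all: by end_near. Qed.

Lemma is_derive_pos_part_powR r x : 1 < r ->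
  is_derive x 1 (fun x => pos_part x `^ r) (r * pos_part x `^ (r - 1)).
Proof.
move=> r1; have r0 : 0 < r by lra.
have [x0|x0|<-] := ltgtP 0 x.
- rewrite pos_partE ?ltW//.
  apply: near_eq_is_derive (is_derive1_powR r x0); near=> y.
  by rewrite pos_partE// ltW//; near: y; exact: lt_nbhsr.
- rewrite pos_part0 ?ltW// powR0 ?subr_eq0 ?gt_eqF// mulr0.
  apply: near_eq_is_derive (is_derive_cst (0 : R) x 1); near=> y.
  rewrite pos_part0 ?powR0 ?gt_eqF// ltW//.
  by near: y; exact: lt_nbhsl.
(* Since [y^r = y^(r-1) y] for [y >= 0], the slope function at [0] is [pos_part y] to the power
   [r - 1], continuous because [r > 1]. *)
- apply/is_derive1_caratheodory; exists (fun y => pos_part y `^ (r - 1)).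
  rewrite (pos_part0 (lexx 0)) !powR0 ?subr_eq0 ?gt_eqF// mulr0; split => //.
    move=> z; rewrite !subr0; case: (leP 0 z) => z0.
      by rewrite pos_partE// mulrC mulr_powRB1.
    by rewrite pos_part0 ?ltW// !powR0 ?subr_eq0 ?gt_eqF// mul0r.
  by apply: continuous_pos_part_powR; rewrite subr_gt0.
Unshelve. all: by end_near. Qed.

(** The primitive of [flux_ab p a b] that vanishes at [0]. Its values at [w] and at [u], each with
    its own exponent and coefficients, add up to the Hamiltonian. *)
Definition energy p a b s : R :=
  p^-1 * (a `^ p * pos_part s `^ p + b `^ p * pos_part (- s) `^ p).

Lemma flux_abE p a b s : flux_ab p a b s =
  a `^ p * pos_part s `^ (p - 1) - b `^ p * pos_part (- s) `^ (p - 1).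
Proof. by []. Qed.

Lemma flux_continuous p a b : 1 < p -> continuous (flux_ab p a b).
Proof.
move=> p1 x; have p0 : 0 < p - 1 by rewrite subr_gt0.
have c := continuous_pos_part_powR p0.
apply: cvgB; (apply: cvgM; first exact: cvg_cst); first exact: c.
apply: (@continuous_comp R R R (fun y => - y) (fun y => pos_part y `^ (p - 1))).
  exact: opp_continuous.
exact: c.
Qed.

Lemma is_derive_energy p a b s : 1 < p ->
  is_derive s 1 (energy p a b) (flux_ab p a b s).
Proof.
move=> p1; have p0 : p != 0 by apply/eqP; lra.
have d1 := is_derive_pos_part_powR s p1.
have d2 := is_derive_pos_part_powR (- s) p1.
have d3 : is_derive s 1 (fun x : R => pos_part (- x) `^ p)
    (- (p * pos_part (- s) `^ (p - 1))).
  have := @is_derive_comp_affine (fun x => pos_part x `^ p) (-1) 0 s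
    (p * pos_part (- s) `^ (p - 1)).
  rewrite mulN1r addr0 mulN1r => /(_ d2).
  by congr is_derive; apply/funext => y; rewrite mulN1r addr0.
apply: (is_derive_eq (is_deriveZf p^-1
  (is_deriveDf (is_deriveZf (a `^ p) d1) (is_deriveZf (b `^ p) d3)))).
by rewrite flux_abE; field; exact: p0.
Qed.

(** Reduces claims about [s < 0] to [s > 0] with the coefficients exchanged. *)
Lemma fluxN p a b s : flux_ab p a b (- s) = - flux_ab p b a s.
Proof. by rewrite !flux_abE opprK opprB. Qed.

Lemma flux_ge0E p a b s : 1 < p -> 0 <= s ->
  flux_ab p a b s = a `^ p * s `^ (p - 1).
Proof.
move=> p1 s0; rewrite flux_abE pos_partE// pos_part0 ?oppr_le0//.
by rewrite powR0 ?mulr0 ?subr0// subr_eq0 gt_eqF.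
Qed.

Lemma flux_le0E p a b s : 1 < p -> s <= 0 ->
  flux_ab p a b s = - (b `^ p * (- s) `^ (p - 1)).
Proof.
by move=> p1 s0; rewrite -[s in LHS]opprK fluxN flux_ge0E// oppr_ge0.
Qed.

Lemma flux0 p a b : 1 < p -> flux_ab p a b 0 = 0.
Proof. by move=> p1; rewrite flux_ge0E// powR0 ?mulr0// subr_eq0 gt_eqF. Qed.

Lemma flux_gt0 p a b s : 1 < p -> 0 < a -> 0 < s -> 0 < flux_ab p a b s.
Proof. by move=> p1 a0 s0; rewrite flux_ge0E ?ltW// mulr_gt0// powR_gt0. Qed.

Lemma flux_lt0 p a b s : 1 < p -> 0 < b -> s < 0 -> flux_ab p a b s < 0.
Proof.
move=> p1 b0 s0; rewrite -[s]opprK fluxN oppr_lt0 flux_gt0//.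
by rewrite oppr_gt0.
Qed.

Lemma flux_mul_ge0 p a b s : 1 < p -> 0 < a -> 0 < b ->
  0 <= flux_ab p a b s * s.
Proof.
move=> p1 a0 b0; have [s0|s0|<-] := ltgtP 0 s; last by rewrite mulr0.
- by rewrite mulr_ge0// ltW// flux_gt0.
- by rewrite mulr_le0// ltW// flux_lt0.
Qed.

Lemma flux_le_norm p a b s : 1 < p ->
  `|flux_ab p a b s| <= (a `^ p + b `^ p) * `|s| `^ (p - 1).
Proof.
move=> p1; rewrite flux_abE (le_trans (ler_normB _ _))// mulrDl.
have n c x : `|c `^ p * pos_part x `^ (p - 1)| = c `^ p * pos_part x `^ (p - 1).
  by rewrite ger0_norm// mulr_ge0 ?powR_ge0.
rewrite !n lerD// ler_wpM2l ?powR_ge0//.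
  by apply: ge0_ler_powR; rewrite ?nnegrE ?pos_part_ge0 ?pos_part_le//; lra.
apply: ge0_ler_powR; rewrite ?nnegrE ?pos_part_ge0//; first lra.
by rewrite -(normrN s) pos_part_le.
Qed.

Lemma flux_homo p a b r s : 1 < p -> 0 <= r ->
  flux_ab p a b (r * s) = r `^ (p - 1) * flux_ab p a b s.
Proof.
move=> p1 r0; have pp x : pos_part (r * x) = r * pos_part x.
  by rewrite /pos_part maxr_pMr// mulr0.
by rewrite !flux_abE -[- (r * s)]mulrN !pp !powRM ?pos_part_ge0//; ring.
Qed.

Lemma flux_scale p a b r s : 0 <= r -> 0 <= a -> 0 <= b ->
  flux_ab p (r * a) (r * b) s = r `^ p * flux_ab p a b s.
Proof. by move=> *; rewrite !flux_abE !powRM//; ring. Qed.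

(** Absorbs a positive eigenvalue into the coefficients, so that energy conservation and uniqueness,
    stated for pairs of fluxes, apply to the eigenvalue problem. *)
Lemma flux_scale1 p lam : 1 < p -> 0 < lam ->
  (fun s => lam * flux_ab p 1 1 s) = flux_ab p (lam `^ p^-1) (lam `^ p^-1).
Proof.
move=> p1 l0; apply/funext => s; have r0 := powR_gt0 p^-1 l0.
rewrite -[lam `^ p^-1]mulr1 flux_scale ?(ltW r0)//.
by rewrite -powRrM mulVf ?powRr1 ?(ltW l0)//; apply/eqP; lra.
Qed.

Definition conj_exp p := p / (p - 1).

Lemma conj_exp_gt1 p : 1 < p -> 1 < conj_exp p.
Proof. by move=> p1; rewrite /conj_exp ltr_pdivlMr ?subr_gt0//; lra. Qed.

Lemma conj_expB1 p : 1 < p -> conj_exp p - 1 = (p - 1)^-1.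
Proof. by move=> p1; rewrite /conj_exp; field; apply/eqP; lra. Qed.

Lemma conj_expK p : 1 < p -> conj_exp (conj_exp p) = p.
Proof.
by move=> p1; rewrite {1}/conj_exp conj_expB1// invrK /conj_exp divfK//; apply/eqP; lra.
Qed.

Lemma fluxK p a b : 1 < p -> 0 < a -> 0 < b ->
  cancel (flux_ab p a b) (flux_ab (conj_exp p) a^-1 b^-1).
Proof.
move=> p1; wlog suff H : / forall a b s, 0 < a -> 0 < b -> 0 <= s ->
    flux_ab (conj_exp p) a^-1 b^-1 (flux_ab p a b s) = s.
  move=> a0 b0 s; case: (leP 0 s) => s0; first exact: H.
  by rewrite -[s in LHS]opprK (fluxN p a b) fluxN H ?opprK ?oppr_ge0 ?ltW//.
move=> {}a {}b s a0 b0 s0; have q1 := conj_exp_gt1 p1.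
rewrite (flux_ge0E _ _ p1 s0) flux_ge0E ?mulr_ge0 ?powR_ge0//.
rewrite conj_expB1// powRM ?powR_ge0// -!powRrM mulfV; last by apply/eqP; lra.
(* The exponent left on [a] is [p/(p-1)], the conjugate exponent, so it meets [a^-1] under the same
   power and cancels. *)
rewrite powRr1// mulrA -/(conj_exp p) -powRM ?invr_ge0 ?(ltW a0)//.
by rewrite mulVf ?gt_eqF// powR1 mul1r.
Qed.

Lemma flux_invK p a b : 1 < p -> 0 < a -> 0 < b ->
  cancel (flux_ab (conj_exp p) a^-1 b^-1) (flux_ab p a b).
Proof.
move=> p1 a0 b0 s.
have := @fluxK (conj_exp p) a^-1 b^-1 (conj_exp_gt1 p1).
by rewrite !invr_gt0 conj_expK// !invrK; apply.
Qed.

(** Splitting [p - 1] as [(p - 2) + 1] requires a nonzero base; at [0] the linear factor gives the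
    value, whatever the sign of [p - 2]. It serves for the classical flux and also for [rhs_p],
    which has the same body. *)
Lemma flux_pE p s : 1 < p -> flux_p p s = flux_ab p 1 1 s.
Proof.
move=> p1; rewrite /flux_p; have [s0|s0|<-] := ltgtP 0 s.
- rewrite flux_ge0E ?ltW// powR1 mul1r gtr0_norm//.
  have -> : p - 1 = p - 2 + 1 by ring.
  by rewrite (@powRD _ s (p - 2) 1) ?powRr1 ?(ltW s0)//; apply/implyP => _; rewrite gt_eqF.
- rewrite flux_le0E ?ltW// powR1 mul1r ltr0_norm//.
  have -> : p - 1 = p - 2 + 1 by ring.
  rewrite (@powRD _ (- s) (p - 2) 1) ?powRr1 ?mulrN ?opprK ?oppr_ge0 ?(ltW s0)//.
  by apply/implyP => _; rewrite oppr_eq0 lt_eqF.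
- by rewrite mulr0 flux0.
Qed.

Lemma energy_ge0 p a b s : 1 < p -> 0 <= energy p a b s.
Proof.
by move=> p1; rewrite mulr_ge0 ?invr_ge0 ?addr_ge0 ?mulr_ge0 ?powR_ge0//; lra.
Qed.

Lemma energy0 p a b : 1 < p -> energy p a b 0 = 0.
Proof.
by move=> p1; rewrite /energy oppr0 pos_part0// powR0 ?mulr0 ?addr0 ?mulr0// gt_eqF//; lra.
Qed.

Lemma energy_eq0 p a b s : 1 < p -> 0 < a -> 0 < b ->
  energy p a b s = 0 -> s = 0.
Proof.
move=> p1 a0 b0 /eqP; have p0 : 0 < p by lra.
rewrite mulf_eq0 invr_eq0 gt_eqF//= paddr_eq0 ?mulr_ge0 ?powR_ge0//.
rewrite !mulf_eq0 (gt_eqF (powR_gt0 p a0)) (gt_eqF (powR_gt0 p b0))/= => /andP[/eqP/powR_eq0_eq0 h /eqP/powR_eq0_eq0 h'].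
by case: (leP 0 s) => s0; [rewrite -(pos_partE s0)|move: h'; rewrite pos_partE; lra].
Qed.

(* On the half-line [0 < s] the flux is controlled by the energy and by [s]
   alone, so no derivative of the flux is needed for a Lipschitz estimate. *)
Lemma flux_energy p a b s : 1 < p -> 0 < s ->
  flux_ab p a b s = p * energy p a b s / s.
Proof.
move=> p1 s0; rewrite flux_ge0E ?ltW// /energy pos_partE ?ltW//.
rewrite (@pos_part0 (- s)) ?oppr_le0 ?ltW// (@powR0 _ p) ?mulr0 ?addr0; last by apply/eqP; lra.
rewrite -[s `^ p](@mulr_powRB1 _ s p) ?(ltW s0)//; last lra.
by field; rewrite gt_eqF//= gt_eqF//; lra.
Qed.

Lemma flux_le p a b s t : 1 < p -> 0 <= s -> s <= t ->
  flux_ab p a b s <= flux_ab p a b t.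
Proof.
move=> p1 s0 st; rewrite !flux_ge0E ?(le_trans s0)// ler_wpM2l ?powR_ge0//.
by apply: ge0_ler_powR; rewrite ?nnegrE ?(le_trans s0 st)//; lra.
Qed.

End FluxCalculus.

(** * Uniqueness for planar Hamiltonian systems with power nonlinearities *)

Section OdeUniqueness.
Variable R : realType.
Implicit Types (p q r s t x y T K : R) (u w f g : R -> R).

(** The derivatives are two-sided even at [s] and [T], so values outside the interval matter, and a
    function known only on [[s, T]] must first be extended. *)
Definition ode_sol (G F : R -> R) s T u w := forall t, s <= t <= T ->
  is_derive t 1 u (G (w t)) /\ is_derive t 1 w (- F (u t)).

Lemma mean_value f (df : R -> R) s T : s <= T ->
  (forall t, s <= t <= T -> is_derive t 1 f (df t)) ->
  exists2 c, s <= c <= T & f T - f s = df c * (T - s).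
Proof.
move=> sT H; have [||c cI e] := @MVT_segment R f df s T sT.
- by move=> x xI; apply: H; move: xI; rewrite in_itv/= => /andP[/ltW-> /ltW->].
- apply: derivable_within_continuous => x xI.
  by have [] := H x _; move: xI; rewrite in_itv/=.
- by exists c => //; move: cI; rewrite in_itv.
Qed.

Lemma derive_ge0_le f (df : R -> R) s T : s <= T ->
  (forall t, s <= t <= T -> is_derive t 1 f (df t)) ->
  (forall t, s <= t <= T -> 0 <= df t) -> f s <= f T.
Proof.
move=> sT H H0; have [c cI e] := mean_value sT H.
by rewrite -subr_ge0 e mulr_ge0 ?subr_ge0 ?H0.
Qed.

Lemma derive_eq0_cst f s T : s <= T ->
  (forall t, s <= t <= T -> is_derive t 1 f 0) -> f s = f T.
Proof.
move=> sT H; have [c cI] := mean_value sT H.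
by rewrite mul0r => /eqP; rewrite subr_eq0 => /eqP.
Qed.

Lemma ode_solS G F s T s' T' u w : s <= s' -> T' <= T ->
  ode_sol G F s T u w -> ode_sol G F s' T' u w.
Proof.
move=> ss TT H t /andP[h1 h2].
by apply: H; rewrite (le_trans ss h1) (le_trans h2 TT).
Qed.

(** The nonnegative function [f^2 exp(-2 K t)] is nonincreasing, because [f f' <= K f^2], and it
    starts at [0]. *)
Lemma gronwall0 f (df : R -> R) K s T : s <= T ->
  (forall t, s <= t <= T -> is_derive t 1 f (df t)) ->
  (forall t, s <= t <= T -> `|df t| <= K * `|f t|) -> f s = 0 -> f T = 0.
Proof.
move=> sT H HK f0.
(* The opposite is taken to get a nondecreasing function; the [+ 0] puts the exponent in the affine
   form of [is_derive_comp_affine]. *)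
pose N t := - ((f t * f t) * expR (- (2 * K) * t + 0)).
pose dN t := - ((f t * f t) * (- (2 * K) * expR (- (2 * K) * t + 0))
   + expR (- (2 * K) * t + 0) * (f t * df t + f t * df t)).
have : N s <= N T.
  apply: (@derive_ge0_le N dN) => // t tI.
    apply: is_deriveNf; apply: is_deriveMf; first by apply: is_deriveMf; apply: H.
    by apply: is_derive_comp_affine; apply: is_derive_expR.
  have : f t * df t <= K * (f t * f t).
    apply: le_trans (ler_norm _) _; rewrite normrM mulrC.
    apply: le_trans (ler_wpM2r (normr_ge0 _) (HK t tI)) _.
    by rewrite -mulrA -normrM ger0_norm// -expr2 sqr_ge0.
  rewrite /dN; have := expR_gt0 (- (2 * K) * t + 0).
  move: (expR _) => E E0 h.
  have -> : - (f t * f t * (- (2 * K) * E) + E * (f t * df t + f t * df t)) =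
    2 * (E * (K * (f t * f t) - f t * df t)) by ring.
  by rewrite mulr_ge0// mulr_ge0 ?(ltW E0)// subr_ge0.
rewrite /N f0 mul0r mul0r oppr0 oppr_ge0 => h.
have := expR_gt0 (- (2 * K) * T + 0) => E0; move: h.
rewrite pmulr_lle0// -expr2 => h; apply/eqP; rewrite -sqrf_eq0.
by rewrite eq_le h sqr_ge0.
Qed.

(** Each flux is the derivative of its energy, so the sum has derivative
    [- G(w) F(u) + F(u) G(w) = 0]. *)
Lemma energy_conserved q A B p C D s T u w : 1 < q -> 1 < p -> s <= T ->
  ode_sol (flux_ab q A B) (flux_ab p C D) s T u w ->
  energy q A B (w T) + energy p C D (u T) =
  energy q A B (w s) + energy p C D (u s).
Proof.
move=> q1 p1 sT H; apply/esym.
apply: (@derive_eq0_cst (fun t => energy q A B (w t) + energy p C D (u t))) => // t tI.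
have [du dw] := H t tI.
apply: (is_derive_eq (is_deriveDf
  (is_derive1_compf (is_derive_energy A B (w t) q1) dw)
  (is_derive1_compf (is_derive_energy C D (u t) p1) du))).
by ring.
Qed.

(** The derivative of the energy is the flux, which on [[m, +oo)] is at least its value at [m];
    hence energy differences control differences of the argument. *)
Lemma energy_dist_ge q A B m x y : 1 < q -> 0 < m -> m <= x -> m <= y ->
  flux_ab q A B m * `|x - y| <= `|energy q A B x - energy q A B y|.
Proof.
move=> q1 m0; wlog xy : x y / x <= y.
  move=> H mx my; case: (leP x y) => [|/ltW] h; first exact: H.
  by rewrite (distrC x) (distrC (energy _ _ _ x)); exact: H.
move=> mx my; rewrite (distrC x) (distrC (energy _ _ _ x)) (ger0_norm (_ : 0 <= y - x)) ?subr_ge0//.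
have [c /andP[c1 c2] ->] := mean_value xy (fun t _ => is_derive_energy A B t q1).
apply: le_trans (ler_norm _); rewrite ler_wpM2r ?subr_ge0//.
by apply: flux_le => //; rewrite ?(ltW m0)// (le_trans mx).
Qed.

Lemma energy_dist_le p C D r x y : 1 < p -> `|x| <= r -> `|y| <= r ->
  `|energy p C D x - energy p C D y| <=
    (C `^ p + D `^ p) * r `^ (p - 1) * `|x - y|.
Proof.
move=> p1; wlog xy : x y / x <= y.
  move=> H mx my; case: (leP x y) => [|/ltW] h; first exact: H.
  by rewrite (distrC x) (distrC (energy _ _ _ x)); exact: H.
move=> xr yr; rewrite (distrC x) (distrC (energy _ _ _ x)).
have [c /andP[c1 c2] ->] := mean_value xy (fun t _ => is_derive_energy C D t p1).
rewrite normrM ler_wpM2r//; apply: le_trans (flux_le_norm _ _ _ p1) _.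
have cr : `|c| <= r.
  move: xr yr; rewrite !ler_norml => /andP[h1 h2] /andP[h3 h4].
  by apply/andP; split; lra.
rewrite ler_wpM2l ?addr_ge0 ?powR_ge0//.
by apply: ge0_ler_powR; rewrite ?nnegrE ?(le_trans _ cr)//; lra.
Qed.

(** Writing the flux as [q E(x) / x] bounds its variation by that of the energy alone, the quantity
    that conservation transfers to [u]. The number [e] bounds the energy that multiplies [y - x]. *)
Lemma flux_dist_le q A B m e x y : 1 < q -> 0 < A -> 0 < m -> m <= x -> m <= y ->
  energy q A B y <= e ->
  `|flux_ab q A B x - flux_ab q A B y| <=
  q * (m^-1 + e * (m^-1 * m^-1) * (flux_ab q A B m)^-1) *
    `|energy q A B x - energy q A B y|.
Proof.
move=> q1 A0 m0 mx my ye.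
have x0 : 0 < x by apply: lt_le_trans mx.
have y0 : 0 < y by apply: lt_le_trans my.
have Gm := flux_gt0 B q1 A0 m0.
rewrite !flux_energy// in Gm *.
have dge := energy_dist_ge A B q1 m0 mx my.
rewrite !flux_energy// in dge.
set G := q * energy q A B m / m in Gm dge *.
move: (energy q A B x) (energy q A B y) (@energy_ge0 R q A B y q1) ye dge => Ex Ey Ey0 ye dge.
have -> : q * Ex / x - q * Ey / y = q * ((Ex - Ey) * x^-1 + Ey * (y - x) * (x^-1 * y^-1)).
  by field; rewrite !gt_eqF.
rewrite normrM (ger0_norm (_ : 0 <= q)); last lra.
rewrite -[leRHS]mulrA ler_wpM2l//; first lra.
have xm : x^-1 <= m^-1 by rewrite lef_pV2.
have ym : y^-1 <= m^-1 by rewrite lef_pV2.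
apply: le_trans (ler_normD _ _) _; rewrite [leRHS]mulrDl; apply: lerD.
  by rewrite normrM mulrC ler_wpM2r// ger0_norm// invr_ge0 ltW.
have xi : 0 <= x^-1 by rewrite invr_ge0 ltW.
have yi : 0 <= y^-1 by rewrite invr_ge0 ltW.
rewrite !normrM (ger0_norm Ey0) (ger0_norm xi) (ger0_norm yi).
have d : `|y - x| <= G^-1 * `|Ex - Ey|.
  by rewrite distrC -(ler_pM2l Gm) mulrA mulfV ?gt_eqF// mul1r.
have xy : x^-1 * y^-1 <= m^-1 * m^-1 by apply: ler_pM => //; rewrite invr_ge0 ltW.
rewrite (mulrAC Ey) -(mulrA (e * _)).
apply: ler_pM => //; first by rewrite !mulr_ge0.
by apply: ler_pM => //; rewrite mulr_ge0.
Qed.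

Section Pair.
Variables (s T : R).
Hypothesis sT : s <= T.

Definition agree_right u1 w1 u2 w2 := exists2 d, 0 < d &
  forall t, s <= t <= T -> t < s + d -> u1 t = u2 t /\ w1 t = w2 t.

(** While both [w] stay above [m], equal energies bound [G(w1) - G(w2)], the derivative of
    [u1 - u2], by a multiple of [u1 - u2], and Gronwall applies. The second equation enters through
    the energy, which is Lipschitz for bounded [u]. *)
Lemma agree_right_pos q A B p C D u1 w1 u2 w2 :
  1 < q -> 1 < p -> 0 < A -> 0 < B -> 0 < C -> 0 < D ->
  ode_sol (flux_ab q A B) (flux_ab p C D) s T u1 w1 ->
  ode_sol (flux_ab q A B) (flux_ab p C D) s T u2 w2 ->
  u1 s = u2 s -> w1 s = w2 s -> 0 < w1 s -> agree_right u1 w1 u2 w2.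
Proof.
move=> q1 p1 A0 B0 C0 D0 S1 S2 us ws w0.
have ss : s <= s <= T by rewrite lexx.
have [du1 dw1] := S1 s ss; have [du2 dw2] := S2 s ss.
pose m := w1 s / 2; have m0 : 0 < m by rewrite divr_gt0.
have mw : m < w1 s by rewrite /m; lra.
have mw2 : m < w2 s by rewrite -ws.
pose r := `|u1 s| + 1.
have ur1 : `|u1 s| < r by rewrite /r; lra.
have ur2 : `|u2 s| < r by rewrite -us.
have /nbhs_ballP[d d0 Hd] : \forall t \near s,
    [/\ m < w1 t, m < w2 t, `|u1 t| < r & `|u2 t| < r].
  near=> t; split; near: t.
  - exact: (cvgr_gt _ (is_derive1_continuous dw1)).
  - exact: (cvgr_gt _ (is_derive1_continuous dw2)).
  - by apply: (cvgr_lt _ (cvg_norm (is_derive1_continuous du1))).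
  - by apply: (cvgr_lt _ (cvg_norm (is_derive1_continuous du2))).
have {}Hd t : s <= t -> t < s + d -> [/\ m < w1 t, m < w2 t, `|u1 t| < r & `|u2 t| < r].
  move=> h1 h2; apply: Hd; rewrite /ball/= distrC ger0_norm ?subr_ge0//.
  by rewrite ltrBlDl.
exists d => // t /andP[st tT] td.
pose e := energy q A B (w1 s) + energy p C D (u1 s).
have E1 x : s <= x <= t -> energy q A B (w1 x) + energy p C D (u1 x) = e.
  move=> /andP[h1 h2]; apply: energy_conserved => //.
  by apply: ode_solS S1; rewrite ?(le_trans h2).
have E2 x : s <= x <= t -> energy q A B (w2 x) + energy p C D (u2 x) = e.
  move=> /andP[h1 h2]; rewrite /e us ws; apply: energy_conserved => //.
  by apply: ode_solS S2; rewrite ?(le_trans h2).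
(* Equal total energy transfers the difference between the two [w] to one between the two [u]. *)
have EE x : s <= x <= t -> energy q A B (w1 x) - energy q A B (w2 x) =
    energy p C D (u2 x) - energy p C D (u1 x).
  by move=> xI; have := E1 x xI; have := E2 x xI; lra.
have ut : u1 t = u2 t.
  apply/eqP; rewrite -subr_eq0; apply/eqP.
  apply: (@gronwall0 (fun t => u1 t - u2 t)
    (fun t => flux_ab q A B (w1 t) - flux_ab q A B (w2 t))
    (q * (m^-1 + e * (m^-1 * m^-1) * (flux_ab q A B m)^-1) *
      ((C `^ p + D `^ p) * r `^ (p - 1))) s t st).
  - move=> x /andP[h1 h2]; apply: is_deriveDf.
      by have [] := S1 x; rewrite ?h1 ?(le_trans h2).
    by apply: is_deriveNf; have [] := S2 x; rewrite ?h1 ?(le_trans h2).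
  - move=> x xI; have /andP[h1 h2] := xI.
    have [/ltW a1 /ltW a2 /ltW a3 /ltW a4] := Hd x h1 (le_lt_trans h2 td).
    have e0 : energy q A B (w2 x) <= e.
      by rewrite -(E2 x xI) lerDl energy_ge0.
    apply: le_trans (flux_dist_le q1 A0 m0 a1 a2 e0) _.
    rewrite -[leRHS]mulrA ler_wpM2l//.
      apply: mulr_ge0; first lra.
      apply: addr_ge0; first by rewrite invr_ge0 ltW.
      rewrite mulr_ge0 ?invr_ge0 ?(ltW (flux_gt0 _ _ _ _))//.
      by rewrite !mulr_ge0 ?invr_ge0 ?(ltW m0)// addr_ge0 ?energy_ge0.
    by rewrite EE// distrC; apply: energy_dist_le.
  - by rewrite us subrr.
split => //; have tI : s <= t <= t by rewrite st lexx.
(* With [u1 = u2] the energies in [w] coincide, and above [m] the energy determines [w]. *)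
have [/ltW a1 /ltW a2 _ _] := Hd t st td.
have := energy_dist_ge A B q1 m0 a1 a2; rewrite EE// ut subrr normr0.
have Gm := flux_gt0 B q1 A0 m0.
by rewrite pmulr_rle0// normr_le0 subr_eq0 => /eqP.
Unshelve. all: by end_near. Qed.

(** A quarter turn of the phase plane: it brings states with [w = 0] and [u] nonzero to states with
    nonzero second coordinate. The sign in [- u] is what exchanges [C] and [D]. *)
Lemma ode_sol_swap q A B p C D u w :
  ode_sol (flux_ab q A B) (flux_ab p C D) s T u w ->
  ode_sol (flux_ab p D C) (flux_ab q A B) s T w (fun t => - u t).
Proof.
move=> H t tI; have [du dw] := H t tI; split; first by rewrite fluxN.
exact: is_deriveNf.
Qed.

Lemma ode_sol_opp q A B p C D u w :
  ode_sol (flux_ab q A B) (flux_ab p C D) s T u w ->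
  ode_sol (flux_ab q B A) (flux_ab p D C) s T (fun t => - u t) (fun t => - w t).
Proof.
move=> H t tI; have [du dw] := H t tI.
by rewrite !fluxN; split; apply: is_deriveNf.
Qed.

Lemma agree_right_swap u1 w1 u2 w2 :
  agree_right w1 (fun t => - u1 t) w2 (fun t => - u2 t) ->
  agree_right u1 w1 u2 w2.
Proof.
by case=> d d0 H; exists d => // t tI td; have [-> /oppr_inj->] := H t tI td.
Qed.

Lemma agree_right_opp u1 w1 u2 w2 :
  agree_right (fun t => - u1 t) (fun t => - w1 t)
    (fun t => - u2 t) (fun t => - w2 t) ->
  agree_right u1 w1 u2 w2.
Proof.
by case=> d d0 H; exists d => // t tI td; have [/oppr_inj-> /oppr_inj->] := H t tI td.
Qed.

Lemma agree_right_neq0 q A B p C D u1 w1 u2 w2 :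
  1 < q -> 1 < p -> 0 < A -> 0 < B -> 0 < C -> 0 < D ->
  ode_sol (flux_ab q A B) (flux_ab p C D) s T u1 w1 ->
  ode_sol (flux_ab q A B) (flux_ab p C D) s T u2 w2 ->
  u1 s = u2 s -> w1 s = w2 s -> w1 s != 0 -> agree_right u1 w1 u2 w2.
Proof.
move=> q1 p1 A0 B0 C0 D0 S1 S2 us ws; rewrite neq_lt => /orP[] w0; last first.
  exact: (@agree_right_pos q A B p C D).
apply: agree_right_opp.
apply: (@agree_right_pos q B A p D C) => //; rewrite ?us ?ws//; try exact: ode_sol_opp.
by rewrite -ws oppr_gt0.
Qed.

Lemma agree_right_sol q A B p C D u1 w1 u2 w2 :
  1 < q -> 1 < p -> 0 < A -> 0 < B -> 0 < C -> 0 < D ->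
  ode_sol (flux_ab q A B) (flux_ab p C D) s T u1 w1 ->
  ode_sol (flux_ab q A B) (flux_ab p C D) s T u2 w2 ->
  u1 s = u2 s -> w1 s = w2 s -> agree_right u1 w1 u2 w2.
Proof.
move=> q1 p1 A0 B0 C0 D0 S1 S2 us ws.
have [w0|w0] := eqVneq (w1 s) 0; last exact: (@agree_right_neq0 q A B p C D).
have [u0|u0] := eqVneq (u1 s) 0; last first.
  apply: agree_right_swap; apply: (@agree_right_neq0 p D C q A B) => //; rewrite ?us//.
  - exact: ode_sol_swap.
  - exact: ode_sol_swap.
  - by rewrite -us oppr_eq0.
(* From the origin the total energy stays [0]; both summands are nonnegative and vanish only at [0],
   so the solution stays at rest. *)
have Z u w t : ode_sol (flux_ab q A B) (flux_ab p C D) s T u w ->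
    u s = 0 -> w s = 0 -> s <= t <= T -> u t = 0 /\ w t = 0.
  move=> S u00 w00 /andP[st tT].
  have := energy_conserved q1 p1 st (ode_solS (lexx s) tT S).
  rewrite u00 w00 !energy0// addr0 => /eqP.
  rewrite paddr_eq0 ?energy_ge0// => /andP[/eqP h1 /eqP h2].
  by split; [apply: energy_eq0 h2|apply: energy_eq0 h1].
exists 1 => // t tI _.
have [-> ->] := Z _ _ _ S1 u0 w0 tI.
by have [-> ->] := Z _ _ _ S2 (etrans (esym us) u0) (etrans (esym ws) w0) tI.
Qed.

End Pair.

(** Continuation: a last time of agreement before [t1] exists by continuity, and local agreement to
    its right forces it to be [t1]. *)
Lemma ode_unique q A B p C D s T u1 w1 u2 w2 :
  1 < q -> 1 < p -> 0 < A -> 0 < B -> 0 < C -> 0 < D ->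
  ode_sol (flux_ab q A B) (flux_ab p C D) s T u1 w1 ->
  ode_sol (flux_ab q A B) (flux_ab p C D) s T u2 w2 ->
  u1 s = u2 s -> w1 s = w2 s ->
  forall t, s <= t <= T -> u1 t = u2 t /\ w1 t = w2 t.
Proof.
move=> q1 p1 A0 B0 C0 D0 S1 S2 us ws t1 /andP[st1 t1T].
apply: contrapT => neq.
(* Agreement is asked at [x] itself rather than on [[s, x]]: local uniqueness restarts from the
   state at a single time. *)
pose S := [set x | [/\ s <= x <= t1, u1 x = u2 x & w1 x = w2 x]].
have Ss : S s by split; rewrite ?lexx.
have Sub x : S x -> x <= t1 by move=> [/andP[]].
have hS : has_sup S by split; [exists s|exists t1 => x /Sub].
pose tau := sup S.
have stau : s <= tau by apply: ub_le_sup => //; exact: hS.2.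
have taut1 : tau <= t1 by apply: ge_sup; [exists s|move=> x /Sub].
have tauI : s <= tau <= T by rewrite stau (le_trans taut1).
have [du1 dw1] := S1 tau tauI; have [du2 dw2] := S2 tau tauI.
(* [N] measures the distance between the two states; were it positive at the supremum, it would be
   positive nearby, where points of [S] lie. *)
have Stau : S tau.
  pose N x := `|u1 x - u2 x| + `|w1 x - w2 x|.
  have cN : {for tau, continuous N}.
    apply: cvgD; apply: cvg_norm; apply: cvgB; exact: is_derive1_continuous.
  have [N0|N0] := leP (N tau) 0.
    split; rewrite ?stau//; apply/eqP; rewrite -subr_eq0 -normr_le0;
    apply: le_trans N0; rewrite ?lerDl ?lerDr//.
  have /nbhs_ballP[d d0 Hd] : \forall x \near tau, 0 < N x.
    exact: (cvgr_gt _ cN _ N0).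
  have [x Sx dx] := sup_adherent d0 hS.
  have xtau : x <= tau by apply: ub_le_sup => //; exact: hS.2.
  have : 0 < N x.
    apply: Hd; rewrite /ball/= ger0_norm ?subr_ge0//.
    by move: dx; rewrite -/tau; lra.
  by case: Sx => _; rewrite /N => -> ->; rewrite !subrr normr0 addr0 ltxx.
have ltau : tau < t1.
  rewrite lt_neqAle taut1 andbT; apply/eqP => e; apply: neq.
  by case: Stau => _; rewrite e.
have [d d0 Hd] := agree_right_sol (le_trans taut1 t1T) q1 p1 A0 B0 C0 D0
  (ode_solS stau (lexx T) S1) (ode_solS stau (lexx T) S2)
  (let: And3 _ h _ := Stau in h) (let: And3 _ _ h := Stau in h).
pose x := Num.min (tau + d / 2) t1.
have x1 : tau < x by rewrite lt_min ltau andbT ltrDl divr_gt0.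
have x2 : x <= t1 by rewrite ge_min lexx orbT.
have x3 : x < tau + d by rewrite gt_min; apply/orP; left; lra.
have : x <= tau.
  apply: ub_le_sup; first exact: hS.2.
  have [|//|h1 h2] := Hd x; first by rewrite (ltW x1) (le_trans x2).
  by split => //; rewrite x2 andbT (le_trans stau)// ltW.
by rewrite leNgt x1.
Qed.

End OdeUniqueness.

(** * Lebesgue integrals on intervals, primitives, and a constancy criterion *)

Section Integration.
Variable R : realType.
Local Notation mu := (@lebesgue_measure R).
Local Notation itg D f := (mu.-integrable D (EFin \o f)).
Implicit Types (f g h : R -> R) (D : set (measurableTypeR R)) (s t x y L : R).

Lemma integrable_addf D f g : measurable D -> itg D f -> itg D g ->
  itg D (fun x => f x + g x).
Proof. by move=> mD hf hg; apply: eq_integrable (integrableD mD hf hg). Qed.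

Lemma integrable_subf D f g : measurable D -> itg D f -> itg D g ->
  itg D (fun x => f x - g x).
Proof. by move=> mD hf hg; apply: eq_integrable (integrableB mD hf hg). Qed.

Lemma integrable_scalef D f (k : R) : measurable D -> itg D f ->
  itg D (fun x => k * f x).
Proof. by move=> mD hf; apply: eq_integrable (integrableZl mD k hf). Qed.

Lemma integrable_normf D f : measurable D -> itg D f -> itg D (fun x => `|f x|).
Proof. by move=> mD hf; apply: eq_integrable (integrable_norm hf). Qed.

Lemma integrable_mulf D f g (M : R) : measurable D -> measurable_fun D f ->
  (forall x, D x -> `|f x| <= M) -> itg D g -> itg D (fun x => f x * g x).
Proof.
move=> mD mf fM hg; have := @integrableMr _ _ _ mu D mD f (EFin \o g) mf _ hg.
apply; exists M; split; first exact: num_real.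
by move=> y My x Dx; apply: le_trans (fM x Dx) (ltW My).
Qed.

Lemma integrable_measurablef D f : itg D f -> measurable_fun D f.
Proof. by move=> /integrableP[/measurable_EFinP]. Qed.

Lemma integrable_dominatedf D f g : measurable D -> measurable_fun D f ->
  itg D g -> (forall x, D x -> `|f x| <= g x) -> itg D f.
Proof.
move=> mD mf hg fg; apply: (le_integrable mD _ _ hg); first exact/measurable_EFinP.
move=> x Dx; rewrite /= lee_fin; apply: le_trans (fg x Dx) _; exact: ler_norm.
Qed.

Lemma integrable_cstf s t (k : R) : itg `[s, t] (fun=> k).
Proof.
apply: measurable_bounded_integrable => //.
- by rewrite /= lebesgue_measure_itv/=; case: ifP => // _; rewrite ltry.
- exists `|k|; split; first exact: num_real.
  by move=> y ky x _; rewrite /= ltW.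
Qed.

Lemma integrable_continuousf f s t :
  {within `[s, t], continuous f} -> itg `[s, t] f.
Proof. by move=> cf; apply: continuous_compact_integrable => //; exact: segment_compact. Qed.

Lemma within_continuous_pointwise f s t :
  (forall x, s <= x <= t -> {for x, continuous f}) -> {within `[s, t], continuous f}.
Proof.
move=> cf; apply: continuous_in_subspaceT => x.
by rewrite inE/= in_itv/=; exact: cf.
Qed.

Lemma Rintegral_ae_eq D f g : measurable D -> itg D f -> itg D g ->
  ae_eq mu D f g -> \int[mu]_(x in D) f x = \int[mu]_(x in D) g x.
Proof.
move=> mD hf hg fg; rewrite /Rintegral; congr fine.
apply: (@ae_eq_integral _ _ _ mu D) => //.
- by case/integrableP: hf.
- by case/integrableP: hg.
- exact: (ae_eq_comp EFin fg).
Qed.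

Lemma Rintegral_split f s m t : s <= m -> m <= t -> itg `[s, t] f ->
  \int[mu]_(x in `[s, t]) f x =
  \int[mu]_(x in `[s, m]) f x + \int[mu]_(x in `]m, t]) f x.
Proof.
move=> sm mt hf; rewrite -(@Rintegral_itvB _ _ _ _ m hf) ?bnd_simp//.
by rewrite addrC subrK.
Qed.

Lemma Rintegral_oc_cc f s t : itg `[s, t] f ->
  \int[mu]_(x in `]s, t]) f x = \int[mu]_(x in `[s, t]) f x.
Proof.
move=> hf; rewrite Rintegral_itv_obnd_cbnd//.
by apply: integrableS hf => //; exact: subset_itv_oc_cc.
Qed.

Lemma integrable_itvS f s t s' t' : s <= s' -> t' <= t ->
  itg `[s, t] f -> itg `[s', t'] f.
Proof.
move=> ss tt hf; apply: integrableS hf => //.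
by apply: subset_itv; rewrite bnd_simp.
Qed.

Lemma Rintegral_derive f (df : R -> R) s t : s <= t ->
  (forall x, s <= x <= t -> is_derive x 1 f (df x)) ->
  (forall x, s <= x <= t -> {for x, continuous df}) ->
  \int[mu]_(x in `[s, t]) df x = f t - f s.
Proof.
rewrite le_eqVlt => /predU1P[<- _ _|st Hf cdf].
  by rewrite set_itv1 Rintegral_set1 subrr.
have cf : {within `[s, t], continuous f}.
  apply: within_continuous_pointwise => x xI.
  by apply: is_derive1_continuous; apply: Hf.
have [_ c1 c2] := (continuous_within_itvP f st).1 cf.
rewrite /Rintegral (@continuous_FTC2 _ df f)//.
- exact: within_continuous_pointwise.
- split => // x; rewrite in_itv/= => /andP[/ltW h1 /ltW h2].
  by have [] := Hf x; rewrite ?h1.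
- move=> x; rewrite in_itv/= => /andP[/ltW h1 /ltW h2].
  have [|d e] := Hf x; first by rewrite h1.
  by rewrite derive1E.
Qed.

(** The margin makes the derivative two-sided at [0] and [L]. Halving it leaves a compact interval
    inside the domain of continuity, on which [h] is integrable. *)
Lemma primitive_exists L d h : 0 <= L -> 0 < d ->
  (forall t, - d < t < L + d -> {for t, continuous h}) ->
  exists P : R -> R, [/\ P 0 = 0,
    forall t, - (d / 2) < t < L + d / 2 -> is_derive t 1 P (h t) &
    forall t, 0 <= t <= L -> P t = \int[mu]_(x in `[0, t]) h x].
Proof.
move=> L0 d0 ch.
pose a := - (d / 2); pose b := L + d / 2.
have hi : itg `[a, b] h.
  apply: integrable_continuousf; apply: within_continuous_pointwise => x.
  by rewrite /a /b => /andP[h1 h2]; apply: ch; apply/andP; split; lra.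
pose I t := \int[mu]_(x in `[a, t]) h x.
have dI t : a < t < b -> is_derive t 1 I (h t).
  move=> /andP[h1 h2]; have ct : {for t, continuous h}.
    by apply: ch; move: h1 h2; rewrite /a /b => h1 h2; apply/andP; split; lra.
  have [e1 e2] := continuous_FTC1_closed h2 hi h1 ct.
  by apply: DeriveDef => //; rewrite -derive1E.
exists (fun t => I t - I 0); split; first by rewrite subrr.
- move=> t tI; apply: (is_derive_eq (is_deriveDf (dI t tI) (is_derive_cst (- I 0) t 1))).
  by rewrite addr0.
- move=> t /andP[t0 tL]; have hit : itg `[a, t] h.
    by apply: integrable_itvS hi => //; rewrite /b; lra.
  rewrite /I (@Rintegral_split h a 0 t) ?Rintegral_oc_cc//.
  + by rewrite addrC addKr.
  + by apply: integrable_itvS hit => //; rewrite /a; lra.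
  + by rewrite /a; lra.
Qed.

(** Over [n] equal pieces the increments of [A] telescope, so
    [|Q L - Q 0| <= K (L / n) (A L - A 0)], which tends to [0]. *)
Lemma superadditive_increment_cst (Q A : R -> R) L (K : R) : 0 <= L ->
  (forall s t, 0 <= s -> s <= t -> t <= L ->
    `|Q t - Q s| <= K * (t - s) * (A t - A s)) -> Q 0 = Q L.
Proof.
move=> L0 H.
have step n (i : nat) : (0 < n)%N -> (i <= n)%N ->
    `|Q (i%:R * (L / n%:R)) - Q 0| <= K * (L / n%:R) * (A (i%:R * (L / n%:R)) - A 0).
  move=> n0; have Ln : 0 <= L / n%:R by rewrite divr_ge0.
  elim: i => [_|i IH iN]; first by rewrite mul0r !subrr normr0 mulr0.
  have h1 : 0 <= i%:R * (L / n%:R) by rewrite mulr_ge0.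
  have h2 : i%:R * (L / n%:R) <= i.+1%:R * (L / n%:R).
    by rewrite ler_wpM2r// ler_nat.
  have h3 : i.+1%:R * (L / n%:R) <= L.
    rewrite mulrCA ler_piMr// ler_pdivrMr ?ltr0n// mul1r ler_nat//.
  have := H _ _ h1 h2 h3; have := IH (ltnW iN).
  rewrite -mulrBl -natrB// subSnn mul1r.
  move: (Q (i.+1%:R * _)) (Q (i%:R * _)) (A (i.+1%:R * _)) (A (i%:R * _)).
  move=> q1 q2 a1 a2 e1 e2.
  have -> : q1 - Q 0 = (q1 - q2) + (q2 - Q 0) by ring.
  apply: le_trans (ler_normD _ _) _; apply: le_trans (lerD e2 e1) _.
  by rewrite -mulrDr addrA subrK.
apply/eqP; rewrite eq_sym -subr_eq0 -normr_le0; apply/ler_addgt0Pl => e e0.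
rewrite addr0; pose C := K * L * (A L - A 0).
pose n := (Num.trunc (`|C| / e)).+1.
have Cn : `|C| / e < n%:R by apply: truncnS_gt.
have n0 : n%:R != 0 :> R by rewrite pnatr_eq0.
have := step n n isT (leqnn n); rewrite mulrC divfK// => /le_trans; apply.
have -> : K * (L / n%:R) * (A L - A 0) = C / n%:R by rewrite /C; field.
apply: le_trans (ler_norm _) _; rewrite normrM normfV (ger0_norm (ler0n _ n)).
by rewrite ler_pdivrMr ?ltr0n// mulrC -ler_pdivrMr// ltW.
Qed.

End Integration.

(** * Integration by parts and the du Bois-Reymond lemma *)

Section WeakForm.
Variable R : realType.
Local Notation mu := (@lebesgue_measure R).
Local Notation itg D f := (mu.-integrable D (EFin \o f)).
Implicit Types (f g h u w : R -> R) (D : set (measurableTypeR R)) (s t x y L p a b : R).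

Lemma within_continuous_bounded h s t : s <= t ->
  {within `[s, t], continuous h} ->
  exists2 M, 0 <= M & forall x, s <= x <= t -> `|h x| <= M.
Proof.
move=> st ch; have cn : {within `[s, t], continuous (fun x => `|h x|)}.
  by move=> x; apply: cvg_norm; exact: ch.
have [c cI H] := EVT_max st cn; by exists `|h c|.
Qed.

(* [Q t := H t * Psi t - \int_0^t (H psi + h Psi)] has increments of order
   [(t - s) * \int_s^t |psi|], hence is constant. *)
Lemma integration_by_parts_ac (H h psi : R -> R) L : 0 <= L ->
  (forall t, 0 <= t <= L -> is_derive t 1 H (h t)) ->
  (forall t, 0 <= t <= L -> {for t, continuous h}) ->
  itg `[0, L] psi -> \int[mu]_(s in `[0, L]) psi s = 0 ->
  \int[mu]_(t in `[0, L]) (H t * psi t) =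
  - \int[mu]_(t in `[0, L]) (h t * \int[mu]_(s in `[0, t]) psi s).
Proof.
move=> L0 dH ch ipsi psi0; pose Psi t := \int[mu]_(s in `[0, t]) psi s.
have cPsi : {within `[0, L], continuous Psi}.
  exact: (parameterized_integral_continuous L0 ipsi).
have wh : {within `[0, L], continuous h} by exact: within_continuous_pointwise.
have wH : {within `[0, L], continuous H}.
  by apply: within_continuous_pointwise => x xI; exact: (is_derive1_continuous (dH x xI)).
have [M M0 hM] := within_continuous_bounded L0 wh.
have [N N0 HN] := within_continuous_bounded L0 wH.
have ih := integrable_continuousf wh.
have iH := integrable_continuousf wH.
have iHpsi : itg `[0, L] (fun t => H t * psi t).
  exact: (integrable_mulf _ (integrable_measurablef iH) HN ipsi).
have ihPsi : itg `[0, L] (fun t => h t * Psi t).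
  apply: integrable_continuousf => x; apply: cvgM; [exact: wh|exact: cPsi].
have iF := integrable_addf (measurable_itv _) iHpsi ihPsi.
have inpsi := integrable_normf (measurable_itv _) ipsi.
pose F t := H t * psi t + h t * Psi t.
pose Q t := H t * Psi t - \int[mu]_(s in `[0, t]) F s.
pose A t := \int[mu]_(s in `[0, t]) `|psi s|.
have diff g s t : itg `[0, L] g -> 0 <= s -> s <= t -> t <= L ->
    \int[mu]_(x in `[0, t]) g x - \int[mu]_(x in `[0, s]) g x =
    \int[mu]_(x in `[s, t]) g x.
  move=> ig s0 st tL; rewrite (@Rintegral_split _ g 0 s t)//.
    rewrite [X in X - _]addrC addrK Rintegral_oc_cc//.
    by apply: integrable_itvS ig.
  by apply: integrable_itvS ig.
have main : Q 0 = Q L.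
  (* The variations of [H] and of [Psi] over [[s, t]] each contribute [M (t - s)] times the integral
     of [|psi|], whence the factor [2 M]. *)
  apply: (@superadditive_increment_cst _ Q A L (2 * M)) => // s t s0 st tL.
  have I g : itg `[0, L] g -> itg `[s, t] g by apply: integrable_itvS.
  have eA : A t - A s = \int[mu]_(x in `[s, t]) `|psi x| by exact: diff.
  have eP : Psi t - Psi s = \int[mu]_(x in `[s, t]) psi x by exact: diff.
  have eH : H t - H s = \int[mu]_(x in `[s, t]) h x.
    apply/esym/Rintegral_derive => // x /andP[h1 h2].
      by apply: dH; rewrite (le_trans s0)//= (le_trans h2).
    by apply: ch; rewrite (le_trans s0)//= (le_trans h2).
  have i1 := integrable_scalef (H t) (measurable_itv _) (I _ ipsi).
  have i2 := integrable_scalef (Psi s) (measurable_itv _) (I _ ih).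
  have i3 := integrable_addf (measurable_itv _) i1 i2.
  have i4 := integrable_subf (measurable_itv _) i3 (I _ iF).
  (* Discrete product rule with [H] frozen at [t] and [Psi] at [s], so that comparison with [F]
     leaves only increments of [H] and [Psi]. *)
  have -> : Q t - Q s = \int[mu]_(x in `[s, t])
      (H t * psi x + Psi s * h x - F x).
    rewrite RintegralB//; last exact: I.
    rewrite RintegralD// !RintegralZl//; [|exact: I|exact: I].
    rewrite -eP -eH -(diff F)// /Q; ring.
  apply: le_trans (le_normr_Rintegral _ i4) _ => //.
  have i5 := integrable_scalef (M * (t - s)) (measurable_itv _) (I _ inpsi).
  have i6 := integrable_addf (measurable_itv _) i5
    (integrable_cstf s t (M * (A t - A s))).
  apply: le_trans (le_Rintegral _ (integrable_normf (measurable_itv _) i4) i6 _) _ => //.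
    move=> x /=; rewrite in_itv/= => /andP[sx xt].
    have xI : 0 <= x <= L by rewrite (le_trans s0)//= (le_trans xt).
    have -> : H t * psi x + Psi s * h x - F x =
      (H t - H x) * psi x + h x * (Psi s - Psi x) by rewrite /F; ring.
    apply: le_trans (ler_normD _ _) _; rewrite !normrM; apply: lerD.
      rewrite ler_wpM2r//.
      have [|c /andP[c1 c2] ->] := @mean_value _ H h x t xt.
        move=> y /andP[y1 y2].
        by apply: dH; rewrite (le_trans s0 (le_trans sx y1)) (le_trans y2).
      rewrite normrM; apply: ler_pM => //.
        by apply: hM; rewrite (le_trans s0 (le_trans sx c1)) (le_trans c2).
      by rewrite ger0_norm ?subr_ge0// lerD2l lerN2.
    apply: ler_pM => //; first exact: hM.
    have xL := le_trans xt tL.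
    rewrite distrC diff// eA.
    apply: le_trans (le_normr_Rintegral _ _) _ => //.
      by apply: integrable_itvS ipsi.
    rewrite [leRHS](@Rintegral_split _ (fun z => `|psi z|) s x t)//; last exact: I.
    by rewrite lerDl Rintegral_ge0.
  rewrite RintegralD//; last exact: integrable_cstf.
  rewrite RintegralZl//; last exact: I.
  rewrite Rintegral_cst// -eA.
  have -> : fine (mu `[s, t]) = t - s.
    rewrite /= lebesgue_measure_itv/= lte_fin.
    by move: st; rewrite le_eqVlt => /predU1P[->|->//]; rewrite ltxx subrr.
  by rewrite le_eqVlt; apply/orP; left; apply/eqP; ring.
have : Q 0 = 0.
  by rewrite /Q /Psi set_itv1 !Rintegral_set1 mulr0 subr0.
rewrite main /Q {1}/Psi psi0 mulr0 sub0r => /eqP; rewrite oppr_eq0 => /eqP.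
by rewrite /F RintegralD// => /eqP; rewrite addr_eq0 => /eqP.
Qed.

(** As [v] is only integrable, [z = v - m] with [m] the mean may be unbounded; its truncation [c(z)]
    to [[-1, 1]], recentred by [k], is an admissible test function. Then [c(z) z], nonnegative and
    zero only where [z = 0], has integral zero. *)
Lemma du_bois_reymond (v : R -> R) L : 0 < L -> itg `[0, L] v ->
  (forall psi : R -> R, measurable_fun (`[0, L]%classic : set (measurableTypeR R)) psi ->
     (exists M : R, forall t, `|psi t| <= M) ->
     \int[mu]_(t in `[0, L]) psi t = 0 ->
     \int[mu]_(t in `[0, L]) (v t * psi t) = 0) ->
  exists m, ae_eq mu (`[0, L]%classic : set (measurableTypeR R)) v (cst m).
Proof.
move=> L0 iv H.
have muL : fine (mu `[0, L]) = L.
  by rewrite /= lebesgue_measure_itv/= lte_fin L0 /= oppr0 addr0.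
pose m := (\int[mu]_(t in `[0, L]) v t) / L; exists m.
pose c (x : R) := Num.max (-1) (Num.min x 1).
have c1 x : `|c x| <= 1.
  by rewrite /c ler_norml le_max lexx/= ge_max ge_min lexx orbT andbT; lra.
pose z t := v t - m.
have iz : itg `[0, L] z.
  exact: (integrable_subf (measurable_itv _) iv (integrable_cstf 0 L m)).
have mz := integrable_measurablef iz.
have mc : measurable_fun (`[0, L]%classic : set (measurableTypeR R)) (c \o z).
  rewrite /c; apply: measurable_maxr => //; exact: measurable_minr.
have ic : itg `[0, L] (c \o z).
  apply: (integrable_dominatedf _ mc (integrable_cstf 0 L 1)) => //.
  by move=> x _; exact: c1.
pose k := (\int[mu]_(t in `[0, L]) (c \o z) t) / L.
pose psi t := (c \o z) t - k.
have ipsi : itg `[0, L] psi.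
  exact: (integrable_subf (measurable_itv _) ic (integrable_cstf 0 L k)).
have psi0 : \int[mu]_(t in `[0, L]) psi t = 0.
  rewrite RintegralB//; last exact: integrable_cstf.
  by rewrite Rintegral_cst// muL /k divfK ?subrr// gt_eqF.
have z0 : \int[mu]_(t in `[0, L]) z t = 0.
  rewrite RintegralB//; last exact: integrable_cstf.
  by rewrite Rintegral_cst// muL /m divfK ?subrr// gt_eqF.
have bpsi t : `|psi t| <= 1 + `|k|.
  by apply: le_trans (ler_normB _ _) _; rewrite lerD2r; exact: c1.
have vpsi := H psi (integrable_measurablef ipsi) (ex_intro _ _ bpsi) psi0.
have ivpsi : itg `[0, L] (fun t => v t * psi t).
  rewrite (_ : (fun t => v t * psi t) = (fun t => psi t * v t)); last first.
    by apply/funext => t; rewrite mulrC.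
  exact: (integrable_mulf _ (integrable_measurablef ipsi) (fun x _ => bpsi x) iv).
have izc : itg `[0, L] (fun t => (c \o z) t * z t).
  by apply: (@integrable_mulf _ _ _ _ 1) => // x _; exact: c1.
have zc0 : \int[mu]_(t in `[0, L]) ((c \o z) t * z t) = 0.
  (* Here [psi + k = c(z)] and [z = v - m]. The first term integrates to [0] by hypothesis, the
     others because [psi] and [z] have mean zero. *)
  transitivity (\int[mu]_(t in `[0, L]) (v t * psi t - m * psi t + k * z t)).
    by apply: eq_Rintegral => t _; rewrite /psi /z; ring.
  rewrite RintegralD//; last exact: integrable_scalef.
    rewrite RintegralB//; last exact: integrable_scalef.
    by rewrite vpsi !RintegralZl// psi0 z0 !mulr0 subr0 addr0.
  by apply: integrable_subf => //; exact: integrable_scalef.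
have cz_ge0 x : 0 <= c x * x.
  rewrite /c; case: (leP x 1) => x1; last by rewrite max_r ?mul1r; lra.
  by case: (leP (-1) x) => x2; [rewrite -expr2 sqr_ge0|lra].
have c0 x : c x = 0 -> x = 0.
  rewrite /c; case: (leP x 1) => x1; last by rewrite max_r; lra.
  by case: (leP (-1) x) => x2; lra.
have ae0 : ae_eq mu (`[0, L]%classic : set (measurableTypeR R)) (EFin \o (fun t => (c \o z) t * z t)) (cst 0%E).
  apply/(ae_eq_integral_abs mu) => //; first by case/integrableP: izc.
  transitivity (\int[mu]_(t in `[0%R, L]) (EFin \o (fun t => ((c \o z) t * z t)%R)) t)%E.
    by apply: eq_integral => t _; rewrite /= ger0_norm.
  have mI : measurable (`[0, L]%classic : set (measurableTypeR R)) by [].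
  have := integrable_fin_num mI izc => /fineK <-.
  by congr EFin; exact: zc0.
apply: filterS ae0 => t /= + tI => /(_ tI) [] /eqP.
have [/eqP|zn] := eqVneq (z t) 0; first by rewrite subr_eq0 => /eqP.
by rewrite mulf_eq0 (negPf zn) orbF => /eqP/c0/eqP; rewrite (negPf zn).
Qed.

End WeakForm.

(** * Equivalence of the weak problem and the planar system *)

Section WeakOde.
Variable R : realType.
Local Notation mu := (@lebesgue_measure R).
Local Notation itg D f := (mu.-integrable D (EFin \o f)).
Implicit Types (f g h u w : R -> R) (s t x y L p a b lam : R).

(** [lam] stays outside the flux because its sign is not known in advance; [flux_scale1] absorbs it
    once it is positive. *)
Definition eigen_ode p a b lam s T u w :=
  ode_sol (flux_ab (conj_exp p) a^-1 b^-1) (fun x => lam * flux_ab p 1 1 x) s T u w.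

Lemma powRB1_le x p : 1 < p -> 0 <= x -> x `^ (p - 1) <= 1 + x `^ p.
Proof.
move=> p1 x0; case: (leP x 1) => x1.
  rewrite (@le_trans _ _ 1)// ?lerDl ?powR_ge0//.
  have := @ge0_ler_powR _ (p - 1) _ x 1; rewrite powR1 !nnegrE; apply => //; lra.
apply: (@le_trans _ _ (x `^ p)); last by rewrite lerDr.
by apply: ler_powR; rewrite ?(ltW x1)//; lra.
Qed.

Lemma integrable_flux p a b L g : 1 < p -> itg `[0, L] g ->
  itg `[0, L] (fun t => `|g t| `^ p) -> itg `[0, L] (fun t => flux_ab p a b (g t)).
Proof.
move=> p1 ig igp.
have i1 := integrable_addf (measurable_itv _) (integrable_cstf 0 L 1) igp.
have i2 := integrable_scalef (a `^ p + b `^ p) (measurable_itv _) i1.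
apply: (integrable_dominatedf _ _ i2) => //.
- have mg := integrable_measurablef ig.
  exact: (measurableT_comp (continuous_measurable_fun (@flux_continuous _ p a b p1)) mg).
- move=> t _; apply: le_trans (flux_le_norm _ _ _ p1) _.
  by rewrite ler_wpM2l ?addr_ge0 ?powR_ge0// powRB1_le.
Qed.

Lemma continuous_normr_powR (r : R) : 0 < r -> continuous (fun x : R => `|x| `^ r).
Proof.
move=> r0 x.
have -> : (fun x : R => `|x| `^ r) = (fun y => pos_part y `^ r) \o Num.norm.
  by apply/funext => y; rewrite /= pos_partE.
apply: continuous_comp; first exact: norm_continuous.
exact: continuous_pos_part_powR.
Qed.

(** Supplies the test functions for the du Bois-Reymond lemma; the mean zero is the boundary
    condition at [L]. *)
Lemma W1p0_bounded p L (psi : R -> R) (M : R) : 0 < p ->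
  measurable_fun (`[0, L]%classic : set (measurableTypeR R)) psi ->
  (forall t, `|psi t| <= M) -> \int[mu]_(t in `[0, L]) psi t = 0 ->
  W1p0 p L (fun t => \int[mu]_(s in `[0, t]) psi s) psi.
Proof.
move=> p0 mpsi bpsi psi0; split => //.
  exact: (integrable_dominatedf _ mpsi (integrable_cstf 0 L M) (fun t _ => bpsi t)).
apply: (integrable_dominatedf _ _ (integrable_cstf 0 L (M `^ p))) => //.
  exact: (measurableT_comp (continuous_measurable_fun (continuous_normr_powR p0)) mpsi).
move=> t _; rewrite ger0_norm ?powR_ge0//.
apply: ge0_ler_powR; rewrite ?nnegrE ?(ltW p0)//.
exact: le_trans (bpsi t).
Qed.

(** Extending [g] by zero makes its primitive continuous on a neighbourhood of [[0, L]], as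
    two-sided derivatives at the ends require. *)
Lemma continuous_extension_primitive L g : 0 <= L -> itg `[0, L] g ->
  exists2 v : R -> R, (forall t, -1 < t < L + 1 -> {for t, continuous v}) &
    (forall t, 0 <= t <= L -> v t = \int[mu]_(s in `[0, t]) g s).
Proof.
move=> L0 ig; pose ge := g \_ (`[0, L]%classic : set (measurableTypeR R)).
have ige : itg `[-1, L + 1] ge.
  rewrite /ge -restrict_EFin; apply/integrable_restrict => //=.
  rewrite setIidr//; apply: subset_itv; rewrite bnd_simp; lra.
exists (fun t => \int[mu]_(s in `[-1, t]) ge s).
  move=> t tI; have l1 : -1 < L + 1 by lra.
  have := parameterized_integral_continuous (ltW l1) ige.
  by move=> /(within_continuous_continuous l1); apply; rewrite in_itv.
move=> t /andP[t0 tL]; rewrite -Rintegral_mkcondr; congr Rintegral.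
apply/seteqP; split => x /=; rewrite !in_itv/=.
  by move=> [/andP[_ ->] /andP[-> _]].
by move=> /andP[x0 xt]; rewrite x0 xt (le_trans xt tL) !andbT; split => //; lra.
Qed.

(** [u] is unconstrained outside [[0, L]], so it may fail to be differentiable at the ends; [U]
    agrees with it on the interval and is differentiable there. *)
Lemma weak_eigen_ode p a b L lam u : 1 < p -> 0 < a -> 0 < b -> 0 < L ->
  weak_eigen_sol (flux_ab p a b) p L lam u ->
  exists U W, [/\ forall t, 0 <= t <= L -> u t = U t,
    eigen_ode p a b lam 0 L U W, U 0 = 0 & U L = 0].
Proof.
move=> p1 a0 b0 L0 [g [[ig igp ue uL] weak]].
have p0 : 0 < p by lra.
have [v cv vE] := continuous_extension_primitive (ltW L0) ig.
have vu t : 0 <= t <= L -> v t = u t by move=> tI; rewrite vE// ue.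
pose h t := flux_ab p 1 1 (v t).
have ch t : - 1 < t < L + 1 -> {for t, continuous h}.
  move=> tI; exact: (continuous_comp (cv t tI) (@flux_continuous _ p 1 1 p1 (v t))).
have [P [P0 dP _]] := primitive_exists (ltW L0) ltr01 ch.
(* The flux up to a constant: testing shows that [flux_ab p a b (g t) - H t] is orthogonal to
   bounded functions of mean zero. *)
pose H t := - lam * P t.
have dH t : - (1 / 2) < t < L + 1 / 2 -> is_derive t 1 H (- lam * h t).
  by move=> tI; apply: is_deriveZf; exact: dP.
have inI t : 0 <= t <= L -> - (1 / 2) < t < L + 1 / 2.
  by move=> /andP[h1 h2]; apply/andP; split; lra.
have inI' t : 0 <= t <= L -> -1 < t < L + 1.
  by move=> /andP[h1 h2]; apply/andP; split; lra.
have clh t : 0 <= t <= L -> {for t, continuous (fun t => - lam * h t)}.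
  by move=> tI; apply: cvgM; [exact: cvg_cst|exact: ch (inI' t tI)].
have iH : itg `[0, L] H.
  apply: integrable_continuousf; apply: within_continuous_pointwise => t tI.
  exact: is_derive1_continuous (dH t (inI t tI)).
have iF := integrable_flux a b p1 ig igp.
have ifh : itg `[0, L] (fun t => flux_ab p a b (g t) - H t).
  exact: (integrable_subf (measurable_itv _) iF iH).
have [|m aem] := du_bois_reymond L0 ifh.
  move=> psi mpsi [M bpsi] psi0.
  have ipsi : itg `[0, L] psi.
    exact: (integrable_dominatedf _ mpsi (integrable_cstf 0 L M) (fun t _ => bpsi t)).
  have i1 : itg `[0, L] (fun t => flux_ab p a b (g t) * psi t).
    rewrite (_ : (fun t => _ * psi t) = (fun t => psi t * flux_ab p a b (g t))).
      exact: (integrable_mulf _ mpsi (fun t _ => bpsi t) iF).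
    by apply/funext => t; rewrite mulrC.
  have i2 : itg `[0, L] (fun t => H t * psi t).
    rewrite (_ : (fun t => _ * psi t) = (fun t => psi t * H t)).
      exact: (integrable_mulf _ mpsi (fun t _ => bpsi t) iH).
    by apply/funext => t; rewrite mulrC.
  have -> : \int[mu]_(t in `[0, L]) ((flux_ab p a b (g t) - H t) * psi t) =
      \int[mu]_(t in `[0, L]) (flux_ab p a b (g t) * psi t - H t * psi t).
    by apply: eq_Rintegral => t _; ring.
  rewrite RintegralB// (weak _ _ (W1p0_bounded p0 mpsi bpsi psi0)).
  rewrite (integration_by_parts_ac (ltW L0) (fun t tI => dH t (inI t tI)) clh ipsi psi0).
  pose Psi t := \int[mu]_(s in `[0, t]) psi s.
  have cPsi : {within `[0, L], continuous Psi}.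
    exact: (parameterized_integral_continuous (ltW L0) ipsi).
  have i3 : itg `[0, L] (fun t => h t * Psi t).
    apply: integrable_continuousf => t; apply: cvgM; last exact: cPsi.
    apply: within_continuous_pointwise => {}t tI; exact: ch (inI' t tI).
  have -> : \int[mu]_(t in `[0, L]) (- lam * h t * \int[mu]_(s in `[0, t]) psi s) =
     \int[mu]_(t in `[0, L]) (- lam * (h t * Psi t)).
    by apply: eq_Rintegral => t _; rewrite mulrA.
  rewrite RintegralZl// mulNr opprK.
  have -> : \int[mu]_(t in `[0, L]) (rhs_p p (u t) * \int[mu]_(s in `[0, t]) psi s) =
     \int[mu]_(t in `[0, L]) (h t * Psi t).
    apply: eq_Rintegral => t; rewrite inE/= in_itv/= => tI.
    by rewrite /h vu// /rhs_p -/(flux_p p (u t)) flux_pE.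
  by rewrite subrr.
(* [W] is the continuous representative of the flux of [g]. Inverting gives [g = G(W)] almost
   everywhere, so [u] is a primitive of a continuous function. *)
pose W t := m + H t.
have dW t : - (1 / 2) < t < L + 1 / 2 -> is_derive t 1 W (- lam * h t).
  move=> tI; apply: (is_derive_eq (is_deriveDf (is_derive_cst m t 1) (dH t tI))).
  by rewrite add0r.
pose G := flux_ab (conj_exp p) a^-1 b^-1.
have cGW t : - (1 / 2) < t < L + 1 / 2 -> {for t, continuous (fun t => G (W t))}.
  move=> tI; have := @flux_continuous _ (conj_exp p) a^-1 b^-1 (conj_exp_gt1 p1) (W t).
  by move/(continuous_comp (is_derive1_continuous (dW t tI))).
have d2 : 0 < 1 / 2 :> R by lra.
have [U [U0 dU UE]] := primitive_exists (ltW L0) d2 cGW.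
have uU t : 0 <= t <= L -> u t = U t.
  move=> tI; rewrite ue// UE//; have /andP[t0 tL] := tI.
  have iGW : itg `[0, L] (fun t => G (W t)).
    apply: integrable_continuousf; apply: within_continuous_pointwise => x xI.
    exact: cGW (inI x xI).
  apply: Rintegral_ae_eq => //.
  - by apply: integrable_itvS ig.
  - by apply: integrable_itvS iGW.
  - apply: (@ae_eq_subset _ _ _ _ mu (`[0, L]%classic)).
      by apply: subset_itv; rewrite bnd_simp.
    apply: filterS aem => x /= + xI => /(_ xI) e.
    rewrite -[LHS](@fluxK _ p a b p1 a0 b0); congr flux_ab.
    by rewrite /W -e subrK.
exists U, W; split => //.
- move=> t tI; have /andP[t0 tL] := tI; split.
    by apply: dU; apply/andP; split; lra.
  by rewrite -uU// -vu// -mulNr; exact: dW (inI t tI).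
- by rewrite -uU// (ltW L0) lexx.
Qed.

(** The weak derivative is the continuous function [G(W)], whose flux is [W]; the weak equation is
    then the second equation integrated by parts against the test function. *)
Lemma eigen_ode_weak p a b L lam u U W : 1 < p -> 0 < a -> 0 < b -> 0 < L ->
  (forall t, 0 <= t <= L -> u t = U t) ->
  eigen_ode p a b lam 0 L U W -> U 0 = 0 -> U L = 0 ->
  weak_eigen_sol (flux_ab p a b) p L lam u.
Proof.
move=> p1 a0 b0 L0 uU S U0 UL; have p0 : 0 < p by lra.
pose G := flux_ab (conj_exp p) a^-1 b^-1.
have cU t : 0 <= t <= L -> {for t, continuous U}.
  by move=> tI; have [d _] := S t tI; exact: is_derive1_continuous d.
have cW t : 0 <= t <= L -> {for t, continuous W}.
  by move=> tI; have [_ d] := S t tI; exact: is_derive1_continuous d.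
have cGW t : 0 <= t <= L -> {for t, continuous (fun t => G (W t))}.
  move=> tI; have := @flux_continuous _ (conj_exp p) a^-1 b^-1 (conj_exp_gt1 p1) (W t).
  by move/(continuous_comp (cW t tI)).
have cfU t : 0 <= t <= L -> {for t, continuous (fun t => flux_ab p 1 1 (U t))}.
  move=> tI; have := @flux_continuous _ p 1 1 p1 (U t).
  by move/(continuous_comp (cU t tI)).
exists (fun t => G (W t)); split; first split.
- apply: integrable_continuousf; exact: within_continuous_pointwise.
- apply: integrable_continuousf; apply: within_continuous_pointwise => t tI.
  have := @continuous_normr_powR _ p0 (G (W t)).
  by move/(continuous_comp (cGW t tI)).
- move=> t tI; have /andP[t0 tL] := tI.
  rewrite uU// -[LHS]subr0 -[X in _ - X]U0; apply/esym/Rintegral_derive => // x /andP[x0 xt].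
    by have [] := S x; rewrite ?x0 ?(le_trans xt).
  by apply: cGW; rewrite x0 (le_trans xt).
- by rewrite uU// (ltW L0) lexx.
move=> phi psi [ipsi _ phiE phiL].
have psi0 : \int[mu]_(s in `[0, L]) psi s = 0 by rewrite -phiE// (ltW L0) lexx.
have -> : \int[mu]_(t in `[0, L]) (flux_ab p a b (G (W t)) * psi t) =
    \int[mu]_(t in `[0, L]) (W t * psi t).
  by apply: eq_Rintegral => t _; rewrite /G flux_invK.
have dW t : 0 <= t <= L -> is_derive t 1 W (- lam * flux_ab p 1 1 (U t)).
  by move=> tI; have [_] := S t tI; rewrite -mulNr.
have clfU t : 0 <= t <= L -> {for t, continuous (fun t => - lam * flux_ab p 1 1 (U t))}.
  by move=> tI; apply: cvgM; [exact: cvg_cst|exact: cfU].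
rewrite (integration_by_parts_ac (ltW L0) dW clfU ipsi psi0).
pose Psi t := \int[mu]_(s in `[0, t]) psi s.
have cPsi : {within `[0, L], continuous Psi}.
  exact: (parameterized_integral_continuous (ltW L0) ipsi).
have i3 : itg `[0, L] (fun t => flux_ab p 1 1 (U t) * Psi t).
  apply: integrable_continuousf => t; apply: cvgM; last exact: cPsi.
  exact: (@within_continuous_pointwise _ _ 0 L cfU).
have -> : \int[mu]_(t in `[0, L]) (- lam * flux_ab p 1 1 (U t) * \int[mu]_(s in `[0, t]) psi s) =
   \int[mu]_(t in `[0, L]) (- lam * (flux_ab p 1 1 (U t) * Psi t)).
  by apply: eq_Rintegral => t _; rewrite mulrA.
rewrite RintegralZl// mulNr opprK; congr (_ * _).
apply: eq_Rintegral => t; rewrite inE/= in_itv/= => tI.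
by rewrite phiE// -uU// /rhs_p -/(flux_p p (u t)) flux_pE.
Qed.

End WeakOde.

(** * Scaling, gluing and periodic extension of solutions *)

Section Reference.
Variable R : realType.
Implicit Types (f g u w U W : R -> R) (s t x y L T m p a b c d k r lam : R).

(** Amplitude [c] and speed [k] multiply [u'] by [c k], hence the flux by [(c k)^(p-1)];
    differentiating the flux brings one more [k], so the eigenvalue gains [k^p]. *)
Lemma eigen_ode_scale p a b lam s T u w c k d : 1 < p -> 0 <= c -> 0 <= k ->
  eigen_ode p a b lam (k * s + d) (k * T + d) u w ->
  eigen_ode p a b (k `^ p * lam) s T (fun t => c * u (k * t + d))
    (fun t => (c * k) `^ (p - 1) * w (k * t + d)).
Proof.
move=> p1 c0 k0 H t /andP[st tT].
have [|du dw] := H (k * t + d); first by rewrite !lerD2r !ler_wpM2l.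
have ck : 0 <= c * k by apply: mulr_ge0.
split.
  apply: (is_derive_eq (is_deriveZf c (is_derive_comp_affine du))).
  rewrite flux_homo ?conj_exp_gt1 ?powR_ge0// conj_expB1// -powRrM mulfV; last by apply/eqP; lra.
  by rewrite powRr1// mulrA.
apply: (is_derive_eq (is_deriveZf _ (is_derive_comp_affine dw))).
rewrite (flux_homo _ _ _ p1 c0) powRM// -(@mulr_powRB1 _ k p)//; last lra.
by ring.
Qed.

Lemma eigen_ode_opp p a b lam s T u w : eigen_ode p a b lam s T u w ->
  eigen_ode p b a lam s T (fun t => - u t) (fun t => - w t).
Proof.
move=> H t tI; have [du dw] := H t tI.
by rewrite !fluxN mulrN; split; apply: is_deriveNf.
Qed.

(** While [w >= 0] only the branch with coefficient [a] is active, and there the asymmetric flux is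
    [a^p] times the symmetric one. *)
Lemma eigen_ode_ge0 p a b lam s T u w : 1 < p -> 0 < a ->
  (forall t, s <= t <= T -> 0 <= w t) ->
  eigen_ode p 1 1 lam s T u w ->
  eigen_ode p a b (a `^ p * lam) s T u (fun t => a `^ p * w t).
Proof.
move=> p1 a0 w0 H t tI; have [du dw] := H t tI; split; last first.
  by apply: (is_derive_eq (is_deriveZf _ dw)); ring.
apply: (is_derive_eq du); have q1 := conj_exp_gt1 p1.
rewrite !flux_ge0E ?mulr_ge0 ?powR_ge0 ?w0// invr1 powR1 mul1r.
rewrite powRM ?powR_ge0 ?w0// conj_expB1// -powRrM -/(conj_exp p) mulrA.
by rewrite -powRM ?invr_ge0 ?(ltW a0)// mulVf ?gt_eqF// powR1 mul1r.
Qed.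

Lemma eigen_ode_le0 p a b lam s T u w : 1 < p -> 0 < b ->
  (forall t, s <= t <= T -> w t <= 0) ->
  eigen_ode p 1 1 lam s T u w ->
  eigen_ode p a b (b `^ p * lam) s T u (fun t => b `^ p * w t).
Proof.
move=> p1 b0 w0 /eigen_ode_opp/(eigen_ode_ge0 a p1 b0) h.
have /h/eigen_ode_opp : forall t, s <= t <= T -> 0 <= - w t.
  by move=> t tI; rewrite oppr_ge0 w0.
congr eigen_ode; apply/funext => t; first by rewrite opprK.
by rewrite mulrN opprK.
Qed.

Lemma eigen_ode_unique p a b lam s T u1 w1 u2 w2 : 1 < p -> 0 < a -> 0 < b ->
  0 < lam -> eigen_ode p a b lam s T u1 w1 -> eigen_ode p a b lam s T u2 w2 ->
  u1 s = u2 s -> w1 s = w2 s ->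
  forall t, s <= t <= T -> u1 t = u2 t /\ w1 t = w2 t.
Proof.
move=> p1 a0 b0 l0 S1 S2.
have r0 := powR_gt0 p^-1 l0.
move: S1 S2; rewrite /eigen_ode flux_scale1// => S1 S2.
by apply: (ode_unique (conj_exp_gt1 p1) p1 _ _ r0 r0 S1 S2); rewrite invr_gt0.
Qed.

Lemma eigen_ode_zero p a b lam s T : 1 < p ->
  eigen_ode p a b lam s T (fun=> 0) (fun=> 0).
Proof.
move=> p1 t _; rewrite !flux0 ?conj_exp_gt1// mulr0 oppr0.
by split; exact: is_derive_cst.
Qed.

(* For [lam <= 0] the product [u w] is nondecreasing and vanishes at both ends. *)
Lemma eigen_ode_nonpos p a b lam L u w : 1 < p -> 0 < a -> 0 < b -> 0 <= L ->
  lam <= 0 -> eigen_ode p a b lam 0 L u w -> u 0 = 0 -> u L = 0 ->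
  forall t, 0 <= t <= L -> u t = 0.
Proof.
move=> p1 a0 b0 L0 l0 S u0 uL.
have q1 := conj_exp_gt1 p1.
have ai : 0 < a^-1 by rewrite invr_gt0.
have bi : 0 < b^-1 by rewrite invr_gt0.
pose G := flux_ab (conj_exp p) a^-1 b^-1.
pose dz t := u t * - (lam * flux_ab p 1 1 (u t)) + w t * G (w t).
have dz0 t : 0 <= dz t.
  apply: addr_ge0; last by rewrite mulrC flux_mul_ge0.
  have -> : u t * - (lam * flux_ab p 1 1 (u t)) = - lam * (flux_ab p 1 1 (u t) * u t) by ring.
  by rewrite mulr_ge0 ?oppr_ge0// flux_mul_ge0.
have mono s t : 0 <= s -> s <= t -> t <= L -> u s * w s <= u t * w t.
  move=> s0 st tL; apply: (@derive_ge0_le _ (fun t => u t * w t) dz) => // x /andP[h1 h2].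
  by have [|du dw] := S x; [rewrite (le_trans s0)//= (le_trans h2)|exact: is_deriveMf].
have uw0 t : 0 <= t <= L -> u t * w t = 0.
  move=> /andP[t0 tL]; apply/eqP; rewrite eq_le.
  have := mono 0 t (lexx 0) t0 tL; have := mono t L t0 tL (lexx L).
  by rewrite u0 uL !mul0r => -> ->.
(* Where [u w = 0] also [u G(w) = 0], so [u^2] has zero derivative and keeps its initial value
   [0]. *)
have uu t : 0 <= t <= L -> 0 <= u t * u t /\ u t * G (w t) = 0.
  move=> tI; split; first by rewrite -expr2 sqr_ge0.
  have /eqP := uw0 t tI; rewrite mulf_eq0 => /orP[/eqP->|/eqP->]; first by rewrite mul0r.
  by rewrite /G flux0// mulr0.
move=> t tI; have /andP[t0 tL] := tI.
have : 0 = u t * u t.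
  rewrite -[LHS](mul0r (u 0)) -[X in X * _]u0.
  apply: (@derive_eq0_cst _ (fun t => u t * u t)) => // x /andP[h1 h2].
  have xI : 0 <= x <= L by rewrite h1 (le_trans h2).
  have [du _] := S x xI; apply: (is_derive_eq (is_deriveMf du du)).
  by rewrite (uu x xI).2 addr0.
by move/esym/eqP; rewrite mulf_eq0 orbb => /eqP.
Qed.

(** At the junction both Caratheodory slope functions take the value [d], so the piecewise one is
    continuous there. *)
Lemma is_derive_if f g m t d : (t <= m -> is_derive t 1 f d) ->
  (m <= t -> is_derive t 1 g d) -> (t = m -> f m = g m) ->
  is_derive t 1 (fun y => if y < m then f y else g y) d.
Proof.
move=> df dg e; have [tm|mt|tm] := ltgtP t m.
- apply: near_eq_is_derive (df (ltW tm)); near=> y.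
  by rewrite ifT//; near: y; exact: lt_nbhsl.
- apply: near_eq_is_derive (dg (ltW mt)); near=> y.
  by rewrite ifF//; apply/negbTE; rewrite -leNgt ltW//; near: y; exact: lt_nbhsr.
- have [tm1 tm2] : t <= m /\ m <= t by rewrite tm.
  have /is_derive1_caratheodory[f1 [h1 c1 e1]] := df tm1.
  have /is_derive1_caratheodory[g1 [h2 c2 e2]] := dg tm2.
  have fg := e tm; subst t.
  apply/is_derive1_caratheodory; exists (fun y => if y < m then f1 y else g1 y).
  split; last by rewrite ltxx.
    by move=> z; rewrite ltxx; case: ifP => _; rewrite -?h1 -?h2 -?fg.
  rewrite /prop_for /continuous_at ltxx e2; apply/cvgrPdist_lt => eps eps0.
  move: c1 c2; rewrite /prop_for /continuous_at e1 e2 => /cvgrPdist_lt/(_ _ eps0) n1 /cvgrPdist_lt/(_ _ eps0) n2.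
  by near=> y; case: ifP => _; near: y.
Unshelve. all: by end_near. Qed.

(** The system expresses derivatives through the state, so equal states at [m] already give equal
    derivatives. *)
Lemma ode_sol_glue (G F : R -> R) s m T u1 w1 u2 w2 :
  ode_sol G F s m u1 w1 -> ode_sol G F m T u2 w2 -> u1 m = u2 m -> w1 m = w2 m ->
  ode_sol G F s T (fun t => if t < m then u1 t else u2 t)
    (fun t => if t < m then w1 t else w2 t).
Proof.
move=> S1 S2 eu ew t /andP[st tT]; split; apply: is_derive_if => //.
- move=> tm; have [|d _] := S1 t; first by rewrite st.
  case: ifP => // /negbT; rewrite -leNgt => mt.
  have e : t = m by apply/eqP; rewrite eq_le tm mt.
  by move: d; rewrite e ew.
- by move=> mt; have [|d _] := S2 t; [rewrite mt|rewrite ltNge mt].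
- move=> tm; have [|_ d] := S1 t; first by rewrite st.
  case: ifP => // /negbT; rewrite -leNgt => mt.
  have e : t = m by apply/eqP; rewrite eq_le tm mt.
  by move: d; rewrite e eu.
- by move=> mt; have [|_ d] := S2 t; [rewrite mt|rewrite ltNge mt].
Qed.

Lemma ode_sol_shift (G F : R -> R) s T d u w : ode_sol G F (s + d) (T + d) u w ->
  ode_sol G F s T (fun t => u (t + d)) (fun t => w (t + d)).
Proof.
move=> H t /andP[h1 h2]; have [|du dw] := H (t + d); first by rewrite !lerD2r h1.
by split; apply: is_derive_comp_shift.
Qed.

Definition periodize (v : R -> R) t := v (t - 2 * (Num.floor (t / 2))%:~R).

Lemma floor_half_bounds t : 0 <= t - 2 * (Num.floor (t / 2))%:~R < 2.
Proof.
have := floor_le (t / 2); have := floorD1_gt (t / 2); rewrite intrD.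
by move: (_%:~R) => n h1 h2; apply/andP; split; lra.
Qed.

Lemma periodizeE v t (n : int) : 2 * n%:~R <= t < 2 * n%:~R + 2 ->
  periodize v t = v (t - 2 * n%:~R).
Proof.
move=> /andP[h1 h2]; rewrite /periodize (@floor_def _ (t / 2) n)//.
by rewrite intrD; apply/andP; split; lra.
Qed.

(** The seams at even integers are the only issue: the end of one period meets the start of the next
    in the same state. *)
Lemma ode_sol_periodize (G F : R -> R) v z s T : ode_sol G F 0 2 v z ->
  v 0 = v 2 -> z 0 = z 2 -> ode_sol G F s T (periodize v) (periodize z).
Proof.
move=> S ev ez t _.
have main f (df : R -> R) : (forall x, 0 <= x <= 2 -> is_derive x 1 f (df x)) ->
    f 0 = f 2 -> df 0 = df 2 -> is_derive t 1 (periodize f) (df (t - 2 * (Num.floor (t / 2))%:~R)).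
  move=> H ef edf; have := floor_half_bounds t.
  move: (Num.floor (t / 2)) => n /andP[r0 r2].
  pose m : R := 2 * n%:~R.
  have D2 : is_derive t 1 (fun y => f (y - m)) (df (t - m)).
    by apply: is_derive_comp_shift; apply: H; rewrite r0 ltW.
  (* Near [t] the extension follows the translate by [2 - m] left of [m = 2 n] and by [- m] right of
     it; in the window from [m - 2] to [m + 2] the floor is [n - 1] or [n]. *)
  apply: near_eq_is_derive (_ : is_derive t 1
     (fun y => if y < m then f (y + (2 - m)) else f (y - m)) _); last first.
    apply: is_derive_if => //.
    + move=> tm; have -> : t - m = 0 by apply/eqP; rewrite eq_le r0 andbT subr_le0.
      rewrite edf; have e2 : t + (2 - m) = 2 by move: r0 tm; rewrite -/m; lra.
      by apply: is_derive_comp_shift; rewrite e2; apply: H; rewrite lexx ler0n.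
    + by move=> _; rewrite subrr addrC subrK -ef.
  have n1 : \forall y \near t, m - 2 < y by apply: lt_nbhsr; move: r0; rewrite -/m; lra.
  have n2 : \forall y \near t, y < m + 2 by apply: lt_nbhsl; move: r2; rewrite -/m; lra.
  near=> y; have y1 : m - 2 < y by near: y.
  have y2 : y < m + 2 by near: y.
  case: ifP => [ym|/negbT]; last first.
    by rewrite -leNgt => my; rewrite (@periodizeE f y n)// -/m my.
  rewrite (@periodizeE f y (n - 1)).
    by congr f; rewrite intrB /m; ring.
  by rewrite intrB; move: y1 ym; rewrite /m => y1 ym; apply/andP; split; lra.
split.
- by apply: (main v (fun x => G (z x))) => [x xI||]; [have [] := S x xI|exact: ev|rewrite ez].
- by apply: (main z (fun x => - F (v x))) => [x xI||]; [have [] := S x xI|exact: ez|rewrite ev].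
Unshelve. all: by end_near. Qed.

End Reference.

(** * The principal orbit and the wave built from it *)

Section Wave.
Variable R : realType.
Implicit Types (u w U W : R -> R) (s t x y L T p a b c d k r lam : R).

(* Phase portrait of the principal eigenfunction [U] of the symmetric problem
   on the unit interval; [W] is its flux. *)
Record principal_orbit p lam U W : Prop := PrincipalOrbit {
  orbit_ode : eigen_ode p 1 1 lam 0 1 U W;
  orbit_lam : 0 < lam;
  orbit_u0 : U 0 = 0;
  orbit_u1 : U 1 = 0;
  orbit_pos : forall t, 0 < t < 1 -> 0 < U t;
  orbit_w0 : 0 < W 0;
  orbit_w1 : W 1 = - W 0;
  orbit_wh : W (1 / 2) = 0;
  orbit_wge0 : forall t, 0 <= t <= 1 / 2 -> 0 <= W t;
  orbit_wle0 : forall t, 1 / 2 <= t <= 1 -> W t <= 0 }.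

(** A nonpositive [lam] would force [U = 0]. So [W] is nonincreasing, and with a wrong sign at an
    end [U] would be nonincreasing on the first half or nondecreasing on the second, against
    [U (1/2) > 0]. *)
Lemma principal_orbit_intro p lam U W : 1 < p -> eigen_ode p 1 1 lam 0 1 U W ->
  U 0 = 0 -> U 1 = 0 -> (forall t, 0 < t < 1 -> 0 < U t) ->
  principal_orbit p lam U W.
Proof.
move=> p1 S U0 U1 Upos; have q1 := conj_exp_gt1 p1.
have halfI : 0 < (1 / 2 : R) < 1 by apply/andP; split; lra.
have halfI' : 0 <= (1 / 2 : R) <= 1 by apply/andP; split; lra.
have h12 : 0 <= 1 / 2 :> R by lra.
have h21 : 1 / 2 <= 1 :> R by lra.
have Uh := Upos _ halfI.
have Uge0 t : 0 <= t <= 1 -> 0 <= U t.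
  move=> /andP[]; rewrite !le_eqVlt => /predU1P[<-|t0]; first by rewrite U0 eqxx.
  by move=> /predU1P[->|t1]; [rewrite U1 eqxx|rewrite Upos ?orbT// t0].
have lam0 : 0 < lam.
  rewrite ltNge; apply/negP => l0.
  by have := eigen_ode_nonpos p1 ltr01 ltr01 ler01 l0 S U0 U1 halfI'; lra.
have Wdec s t : 0 <= s -> s <= t -> t <= 1 -> W t <= W s.
  move=> s0 st t1; rewrite -lerN2.
  apply: (@derive_ge0_le _ (fun x => - W x) (fun x => lam * flux_ab p 1 1 (U x))) => //.
    move=> x /andP[h1 h2]; have [|_ d] := S x; first by rewrite (le_trans s0)//= (le_trans h2).
    by apply: (is_derive_eq (is_deriveNf d)); rewrite opprK.
  move=> x /andP[h1 h2]; have := Uge0 x; rewrite (le_trans s0)//= (le_trans h2)//= => /(_ isT) u0.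
  by rewrite flux_ge0E// mulr_ge0 ?(ltW lam0)// mulr_ge0 ?powR_ge0.
have dU x : 0 <= x <= 1 -> is_derive x 1 U (flux_ab (conj_exp p) 1^-1 1^-1 (W x)).
  by move=> xI; have [] := S x xI.
have W0 : 0 < W 0.
  rewrite ltNge; apply/negP => w0.
  have : - U 0 <= - U (1 / 2).
    apply: (@derive_ge0_le _ (fun x => - U x) (fun x => - flux_ab (conj_exp p) 1^-1 1^-1 (W x)) 0 (1 / 2)) => //.
      by move=> x /andP[x0 xh]; apply: is_deriveNf; apply: dU; rewrite x0 (le_trans xh).
    move=> x /andP[x0 xh]; rewrite flux_le0E//.
      by rewrite opprK mulr_ge0 ?powR_ge0.
    by apply: le_trans w0; apply: Wdec => //; apply: le_trans xh _.
  by rewrite U0; lra.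
have W1 : W 1 < 0.
  rewrite ltNge; apply/negP => w0.
  have : U (1 / 2) <= U 1.
    apply: (@derive_ge0_le _ U (fun x => flux_ab (conj_exp p) 1^-1 1^-1 (W x)) (1 / 2) 1) => //.
      by move=> x /andP[x0 xh]; apply: dU; rewrite xh (le_trans _ x0).
    move=> x /andP[x0 xh]; rewrite flux_ge0E//.
      by rewrite mulr_ge0 ?powR_ge0.
    by apply: le_trans w0 _; apply: Wdec => //; apply: le_trans x0.
  by rewrite U1; lra.
(* [U] vanishes at both ends, so equal energy makes the two fluxes equal in absolute value. *)
have W10 : W 1 = - W 0.
  have := S; rewrite /eigen_ode flux_scale1// => /(energy_conserved q1 p1 ler01).
  rewrite U0 U1 energy0// !addr0 /energy => /mulfI.
  rewrite invr1 powR1 !mul1r (pos_part0 (ltW W1)) (@pos_partE _ (W 0) (ltW W0)).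
  rewrite (@pos_part0 _ (- W 0)) ?oppr_le0 ?(ltW W0)// (@pos_partE _ (- W 1)) ?oppr_ge0 ?(ltW W1)//.
  rewrite powR0 ?add0r ?addr0; last by apply/eqP; lra.
  have i0 : (conj_exp p)^-1 != 0 by rewrite invr_eq0; apply/eqP; lra.
  move=> /(_ i0) /powR_injective; rewrite !nnegrE oppr_ge0 => h.
  by rewrite -(h _ (ltW W1) (ltW W0)) ?opprK//; lra.
have Wsym t : 0 <= t <= 1 -> W t = - W (1 - t).
  (* Reflection about [1/2] changes the sign of the flux, and by [W10] it starts in the same state;
     uniqueness then makes [W] odd about [1/2]. *)
  have S' : eigen_ode p 1 1 lam 0 1 (fun t => U (-1 * t + 1)) (fun t => - W (-1 * t + 1)).
    move=> x /andP[x0 x1]; have [|du dw] := S (-1 * x + 1); first by apply/andP; split; lra.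
    split.
      apply: (is_derive_eq (is_derive_comp_affine du)).
      by rewrite fluxN !mulN1r.
    by apply: (is_derive_eq (is_deriveNf (is_derive_comp_affine dw))); ring.
  have eu : U 0 = U (-1 * 0 + 1) by rewrite mulr0 add0r U0 U1.
  have ew : W 0 = - W (-1 * 0 + 1) by rewrite mulr0 add0r W10 opprK.
  move=> tI; have [_ ->] := eigen_ode_unique p1 ltr01 ltr01 lam0 S S' eu ew tI.
  by rewrite mulN1r addrC.
have Wh : W (1 / 2) = 0.
  have := Wsym _ halfI'; rewrite (_ : 1 - 1 / 2 = 1 / 2 :> R); lra.
split => //.
- by move=> t /andP[h1 h2]; rewrite -Wh; apply: Wdec.
- by move=> t /andP[h1 h2]; rewrite -Wh; apply: Wdec.
Qed.

(** Effect on the flux of stretching time by [l], a slope factor [1/l] under the power [p - 1], and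
    of replacing the coefficient [1] by [a]. *)
Definition flux_factor p a l : R := l^-1 `^ (p - 1) * a `^ p.

Definition wave_flux p W a b t : R :=
  if t < t0 a b then flux_factor p a (2 * t0 a b) * W (t / (2 * t0 a b))
  else flux_factor p b (2 * (1 - t0 a b)) *
    W ((t + 1 - 2 * t0 a b) / (2 * (1 - t0 a b))).

Lemma t0_itv a b : 0 < a -> 0 < b -> 0 < t0 a b < 1.
Proof.
by move=> a0 b0; rewrite /t0 divr_gt0 ?addr_gt0//= ltr_pdivrMr ?addr_gt0//; lra.
Qed.

Lemma t0_swap a b : 0 < a -> 0 < b -> t0 b a = 1 - t0 a b.
Proof.
by move=> a0 b0; rewrite /t0 (addrC b a); field; rewrite gt_eqF ?addr_gt0.
Qed.

Lemma phi_ab_minusE (phi : R -> R) a b t : 0 < a -> 0 < b ->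
  phi_ab_minus phi a b t = - phi_ab_plus phi b a t.
Proof.
move=> a0 b0; rewrite /phi_ab_minus /phi_ab_plus (t0_swap a0 b0).
have -> : 1 - (1 - t0 a b) = t0 a b by ring.
have -> : t + 1 - 2 * (1 - t0 a b) = t + 2 * t0 a b - 1 by ring.
by case: ifP.
Qed.

Section Orbit.
Variables (p lam : R) (U W : R -> R).
Hypothesis p1 : 1 < p.
Hypothesis orb : principal_orbit p lam U W.

Lemma half_wave_ode a b : 0 < a -> 0 < b ->
  eigen_ode p a b (((a + b) / 2) `^ p * lam) 0 1
    (phi_ab_plus U a b) (wave_flux p W a b).
Proof.
move=> a0 b0; have /andP[t00 t01] := t0_itv a0 b0; have ab := addr_gt0 a0 b0.
have half : 1 / 2 < 1 :> R by lra.
have Sl : ode_sol (flux_ab (conj_exp p) 1^-1 1^-1) (fun x => lam * flux_ab p 1 1 x) 0 (1 / 2) U W.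
  exact: ode_solS (lexx 0) (ltW half) (orbit_ode orb).
have Sr : ode_sol (flux_ab (conj_exp p) 1^-1 1^-1) (fun x => lam * flux_ab p 1 1 x) (1 / 2) 1 U W.
  by apply: ode_solS _ (lexx 1) (orbit_ode orb); lra.
have := eigen_ode_ge0 b p1 a0 (orbit_wge0 orb) Sl.
have := eigen_ode_le0 a p1 b0 (orbit_wle0 orb) Sr.
pose la := 2 * t0 a b; pose lb := 2 * (1 - t0 a b).
have la0 : 0 < la by rewrite /la; lra.
have lb0 : 0 < lb by rewrite /lb; lra.
(* [e] is the coefficient and [l0] the stretching factor of one half; the relation
   [e = (a + b) / 2 * l0] is what produces the common eigenvalue. *)
have scale (l0 e d s T S T' : R) u w : 0 < l0 -> e = ((a + b) / 2 * l0) ->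
   S = l0^-1 * s + d -> T' = l0^-1 * T + d -> 0 < e ->
   eigen_ode p a b (e `^ p * lam) S T' u (fun t => e `^ p * w t) ->
   eigen_ode p a b (((a + b) / 2) `^ p * lam) s T (fun t => u (l0^-1 * t + d))
     (fun t => flux_factor p e l0 * w (l0^-1 * t + d)).
  move=> l00 eE -> -> e0 H.
  have li : 0 <= l0^-1 by rewrite invr_ge0 ltW.
  have := eigen_ode_scale p1 ler01 li H.
  have -> : l0^-1 `^ p * (e `^ p * lam) = ((a + b) / 2) `^ p * lam.
    rewrite mulrA -powRM ?(ltW e0)//.
    by have -> : l0^-1 * e = (a + b) / 2 by rewrite eE; field; rewrite gt_eqF.
  congr eigen_ode; apply/funext => t; rewrite mul1r//.
  by rewrite /flux_factor mulrA.
move=> Hb Ha.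
have t0n : 1 - t0 a b != 0 by rewrite gt_eqF//; lra.
have t0n' : t0 a b != 0 by rewrite gt_eqF.
have abn : a + b != 0 by rewrite gt_eqF.
have la_half : la^-1 * t0 a b + 0 = 1 / 2 by rewrite /la; field.
have lb_half : lb^-1 * t0 a b + (1 - 2 * t0 a b) / lb = 1 / 2 by rewrite /lb; field.
have {}Ha : eigen_ode p a b (((a + b) / 2) `^ p * lam) 0 (t0 a b)
    (fun t => U (la^-1 * t + 0)) (fun t => flux_factor p a la * W (la^-1 * t + 0)).
  apply: (scale la a 0 0 (t0 a b) 0 (1 / 2)) Ha => //.
  - by rewrite /la /t0; field.
  - by rewrite mulr0 addr0.
have {}Hb : eigen_ode p a b (((a + b) / 2) `^ p * lam) (t0 a b) 1
    (fun t => U (lb^-1 * t + (1 - 2 * t0 a b) / lb))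
    (fun t => flux_factor p b lb * W (lb^-1 * t + (1 - 2 * t0 a b) / lb)).
  apply: (scale lb b ((1 - 2 * t0 a b) / lb) (t0 a b) 1 (1 / 2) 1) Hb => //.
  - by rewrite /lb /t0; field.
  - by rewrite /lb; field.
(* The flux factors of the two halves may differ, yet the fluxes match: both vanish at the junction
   because [W (1/2) = 0]. *)
have := ode_sol_glue Ha Hb; rewrite la_half lb_half (orbit_wh orb) !mulr0 => /(_ erefl erefl).
have ea t : la^-1 * t + 0 = t / (2 * t0 a b) by rewrite addr0 mulrC.
have eb t : lb^-1 * t + (1 - 2 * t0 a b) / lb =
    (t + 1 - 2 * t0 a b) / (2 * (1 - t0 a b)).
  by rewrite mulrC -mulrDl addrA.
rewrite /eigen_ode; congr ode_sol; apply/funext => t.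
  by rewrite /phi_ab_plus ea eb.
by rewrite /wave_flux ea eb.
Qed.

Lemma phi_ab_plus0 a b : 0 < a -> 0 < b -> phi_ab_plus U a b 0 = 0.
Proof.
move=> a0 b0; have /andP[t00 t01] := t0_itv a0 b0.
by rewrite /phi_ab_plus t00 mul0r (orbit_u0 orb).
Qed.

Lemma phi_ab_plus1 a b : 0 < a -> 0 < b -> phi_ab_plus U a b 1 = 0.
Proof.
move=> a0 b0; have /andP[t00 t01] := t0_itv a0 b0.
rewrite /phi_ab_plus ifF; last by apply/negbTE; rewrite -leNgt ltW.
rewrite (_ : _ / _ = 1) ?(orbit_u1 orb)//.
by field; rewrite gt_eqF//; lra.
Qed.

Lemma phi_ab_plus_gt0 a b t : 0 < a -> 0 < b -> 0 < t < 1 ->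
  0 < phi_ab_plus U a b t.
Proof.
move=> a0 b0 /andP[h1 h2]; have /andP[t00 t01] := t0_itv a0 b0.
rewrite /phi_ab_plus; case: ifP => [tt|/negbT].
  have d0 : 0 < 2 * t0 a b by lra.
  apply: (orbit_pos orb); apply/andP; split; first by rewrite divr_gt0.
  by rewrite ltr_pdivrMr//; lra.
rewrite -leNgt => tt; have d0 : 0 < 2 * (1 - t0 a b) by lra.
apply: (orbit_pos orb); apply/andP; split; first by rewrite divr_gt0//; lra.
by rewrite ltr_pdivrMr//; lra.
Qed.

Lemma flux_factor_gt0 a l : 0 < a -> 0 < l -> 0 < flux_factor p a l.
Proof. by move=> a0 l0; rewrite mulr_gt0// powR_gt0// invr_gt0. Qed.

Lemma wave_flux0 a b : 0 < a -> 0 < b ->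
  wave_flux p W a b 0 = flux_factor p a (2 * t0 a b) * W 0.
Proof.
move=> a0 b0; have /andP[t00 t01] := t0_itv a0 b0.
by rewrite /wave_flux t00 mul0r.
Qed.

Lemma wave_flux0_gt0 a b : 0 < a -> 0 < b -> 0 < wave_flux p W a b 0.
Proof.
move=> a0 b0; have /andP[t00 t01] := t0_itv a0 b0.
by rewrite wave_flux0// mulr_gt0 ?(orbit_w0 orb)// flux_factor_gt0// mulr_gt0.
Qed.

(** A consequence of [W 1 = - W 0]: the positive half-wave ends in the state where the negative one
    starts, and conversely with [a] and [b] exchanged. *)
Lemma wave_flux1 a b : 0 < a -> 0 < b ->
  wave_flux p W a b 1 = - wave_flux p W b a 0.
Proof.
move=> a0 b0; have /andP[t00 t01] := t0_itv a0 b0.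
rewrite wave_flux0// (t0_swap a0 b0) /wave_flux ifF; last by apply/negbTE; rewrite -leNgt ltW.
rewrite (_ : _ / _ = 1) ?(orbit_w1 orb) ?mulrN//.
by field; rewrite gt_eqF//; lra.
Qed.

Definition full_wave a b t : R :=
  if t < 1 then phi_ab_plus U a b t else phi_ab_minus U a b (t - 1).

Definition full_wave_flux a b t : R :=
  if t < 1 then wave_flux p W a b t else - wave_flux p W b a (t - 1).

Lemma phi_abE a b : phi_ab U a b = periodize (full_wave a b).
Proof. by []. Qed.

Lemma full_wave_ode a b : 0 < a -> 0 < b ->
  eigen_ode p a b (((a + b) / 2) `^ p * lam) 0 2 (full_wave a b) (full_wave_flux a b).
Proof.
move=> a0 b0; have S1 := half_wave_ode a0 b0.
have := eigen_ode_opp (half_wave_ode b0 a0); rewrite (addrC b a) => S2.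
have {}S2 : ode_sol (flux_ab (conj_exp p) a^-1 b^-1)
  (fun x => ((a + b) / 2) `^ p * lam * flux_ab p 1 1 x) 1 2
  (fun t => - phi_ab_plus U b a (t - 1)) (fun t => - wave_flux p W b a (t - 1)).
  have e : 2 - 1 = 1 :> R by ring.
  have : ode_sol (flux_ab (conj_exp p) a^-1 b^-1)
      (fun x => ((a + b) / 2) `^ p * lam * flux_ab p 1 1 x) (1 - 1) (2 - 1)
      (fun t => - phi_ab_plus U b a t) (fun t => - wave_flux p W b a t).
    by rewrite e subrr.
  exact: ode_sol_shift.
have := ode_sol_glue S1 S2; rewrite subrr phi_ab_plus0// phi_ab_plus1// oppr0 wave_flux1//.
move=> /(_ erefl erefl); rewrite /eigen_ode; congr ode_sol.
by apply/funext => t; rewrite /full_wave phi_ab_minusE.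
Qed.

Definition phi_ab_flux a b := periodize (full_wave_flux a b).

Lemma phi_ab_ode a b s T : 0 < a -> 0 < b ->
  eigen_ode p a b (((a + b) / 2) `^ p * lam) s T (phi_ab U a b) (phi_ab_flux a b).
Proof.
move=> a0 b0; have n12 : (2 < 1 :> R) = false by apply/negbTE; rewrite -leNgt; lra.
have e21 : 2 - 1 = 1 :> R by ring.
rewrite phi_abE; apply: ode_sol_periodize (full_wave_ode a0 b0) _ _.
  by rewrite /full_wave ltr01 n12 e21 phi_ab_minusE// phi_ab_plus0// phi_ab_plus1// oppr0.
by rewrite /full_wave_flux ltr01 n12 e21 wave_flux1// opprK.
Qed.

(** The fluxes at [0] and at [-1] have opposite signs, so one of the two translates, scaled by a
    positive constant, matches any nonzero initial flux. *)
Lemma phi_ab_flux0_gt0 a b : 0 < a -> 0 < b -> 0 < phi_ab_flux a b 0.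
Proof.
move=> a0 b0; rewrite /phi_ab_flux (@periodizeE _ _ 0 0); last by rewrite mulr0 add0r lexx ltr0n.
by rewrite mulr0 subr0 /full_wave_flux ltr01 wave_flux0_gt0.
Qed.

Lemma phi_ab_fluxN1_lt0 a b : 0 < a -> 0 < b -> phi_ab_flux a b (- 1) < 0.
Proof.
move=> a0 b0; rewrite /phi_ab_flux (@periodizeE _ _ (- 1) (- 1)); last first.
  by rewrite mulrN1; apply/andP; split; lra.
have -> : - 1 - 2 * (- 1)%:~R = 1 :> R by rewrite mulrN1; ring.
by rewrite /full_wave_flux ltxx subrr oppr_lt0 wave_flux0_gt0.
Qed.

(** Each half-wave has a strict sign inside its unit interval. That every zero is an integer is what
    quantizes the eigenvalues. *)
Lemma phi_ab_eq0 a b t : 0 < a -> 0 < b ->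
  (phi_ab U a b t = 0) <-> (exists n : int, t = n%:~R).
Proof.
move=> a0 b0; rewrite phi_abE /periodize.
have := floor_half_bounds t; set n := Num.floor (t / 2).
set r := t - 2 * n%:~R => /andP[r0 r2].
have tE : t = r + 2 * n%:~R by rewrite /r subrK.
split; last first.
  case=> k tk; have rk : r = (k - 2 * n)%:~R by rewrite /r tk intrB intrM.
  have : (k - 2 * n == 0) || (k - 2 * n == 1).
    move: r0 r2; rewrite rk (ler_int _ 0) (ltr_int _ _ 2).
    by case: (k - 2 * n) => [[|[|]]|].
  case/orP => /eqP e; rewrite rk e /full_wave.
    by rewrite ltr01 phi_ab_plus0.
  by rewrite ltxx subrr phi_ab_minusE// phi_ab_plus0// oppr0.
rewrite /full_wave; case: ifP => [r1|/negbT].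
  move: r0; rewrite le_eqVlt => /predU1P[r0 _|r0].
    by exists (2 * n); rewrite tE -r0 add0r intrM.
  by have := @phi_ab_plus_gt0 a b r a0 b0; rewrite r0 r1 => /(_ isT); lra.
rewrite -leNgt le_eqVlt phi_ab_minusE// => /predU1P[r1 _|r1].
  by exists (1 + 2 * n); rewrite tE -r1 intrD intrM.
have := @phi_ab_plus_gt0 b a (r - 1) b0 a0.
rewrite (_ : 0 < r - 1 < 1); last by apply/andP; split; lra.
by move=> /(_ isT); lra.
Qed.


End Orbit.
End Wave.

(** * Eigenvalues and eigenfunctions from uniqueness *)

Section Spectrum.
Variable R : realType.
Implicit Types (u w U W : R -> R) (s t x y L T p a b c d r lam : R).

(** Lets [powRM] separate [k / L] from [pi_p] in the eigenvalues. *)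
Lemma pi_p_ge0 p : 0 <= pi_p p.
Proof. by rewrite mulr_ge0// Rintegral_ge0// => t _; exact: powR_ge0. Qed.

Lemma lambda_kpE p (k : nat) L : 0 < L ->
  lambda_kp p k L = (k%:R / L) `^ p * lambda_kp p 1 1.
Proof.
move=> L0; have pi0 := pi_p_ge0 p.
rewrite /lambda_kp mulr1n mul1r divr1 mulrAC powRM ?divr_ge0 ?(ltW L0)//.
by ring.
Qed.

Lemma lambda_ab_kpE p a b (k : nat) L : 0 < a -> 0 < b -> 0 < L ->
  lambda_ab_kp p a b k L =
  (k%:R / L) `^ p * (((a + b) / 2) `^ p * lambda_kp p 1 1).
Proof.
move=> a0 b0 L0; rewrite /lambda_ab_kp (lambda_kpE _ _ L0) !mulrA; congr (_ * _).
have ab : 0 <= (a + b) / 2 by rewrite divr_ge0// addr_ge0// ltW.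
have Li : 0 <= 1%:R / L by rewrite divr_ge0// ltW.
have kL : 0 <= k%:R / L by rewrite divr_ge0// ltW.
have kab : 0 <= k%:R * (a + b) / 2 by rewrite -mulrA mulr_ge0.
rewrite -(powRM p kab Li) -(powRM p kL ab). congr (_ `^ p * _).
by ring.
Qed.

(** Only values on [[0, 1]] are sampled, so the given eigenfunction may be replaced by [U], which
    solves the system. *)
Lemma phi_ab_ext f g a b t : 0 < a -> 0 < b ->
  (forall x, 0 <= x <= 1 -> f x = g x) -> phi_ab f a b t = phi_ab g a b t.
Proof.
move=> a0 b0 fg.
have ext a' b' r : 0 < a' -> 0 < b' -> 0 <= r <= 1 ->
    phi_ab_plus f a' b' r = phi_ab_plus g a' b' r :> R.
  move=> a'0 b'0 /andP[r0 r1]; have /andP[t00 t01] := t0_itv a'0 b'0.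
  rewrite /phi_ab_plus; case: ifP => [rt|/negbT].
    have d0 : 0 < 2 * t0 a' b' by lra.
    apply: fg; apply/andP; split; first by rewrite divr_ge0// ltW.
    by rewrite ler_pdivrMr//; lra.
  rewrite -leNgt => rt; have d0 : 0 < 2 * (1 - t0 a' b') by lra.
  apply: fg; apply/andP; split; first by rewrite divr_ge0 ?(ltW d0)//; lra.
  by rewrite ler_pdivrMr//; lra.
rewrite /phi_ab; have := floor_half_bounds t.
move: (t - _) => r /andP[r0 r2]; case: ifP => [r1|/negbT].
  by apply: ext; rewrite ?r0 ?(ltW r1).
rewrite -leNgt => r1; rewrite !phi_ab_minusE// ext//.
by apply/andP; split; lra.
Qed.

Section Orbit.
Variables (p lam a b L : R) (U W : R -> R).
Hypothesis p1 : 1 < p.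
Hypothesis a0 : 0 < a.
Hypothesis b0 : 0 < b.
Hypothesis L0 : 0 < L.
Hypothesis orb : principal_orbit p lam U W.

Let Lam := ((a + b) / 2) `^ p * lam.

Let Lam_gt0 : 0 < Lam.
Proof. by rewrite mulr_gt0 ?(orbit_lam orb)// powR_gt0// divr_gt0// addr_gt0. Qed.

Lemma phi_ab_int (n : int) : phi_ab U a b n%:~R = 0.
Proof. by apply/(phi_ab_eq0 orb _ a0 b0); exists n. Qed.

Lemma wave_eigenfunction (k : nat) (n : int) c u : (0 < k)%N -> 0 < c ->
  (forall t, 0 <= t <= L -> u t = c * phi_ab U a b (k%:R * t / L + n%:~R)) ->
  eigenfunction_ab p a b L ((k%:R / L) `^ p * Lam) u.
Proof.
move=> k0 c0 uE; have Ln : L != 0 by rewrite gt_eqF.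
have kn : k%:R != 0 :> R by rewrite pnatr_eq0 -lt0n.
have kL : 0 <= k%:R / L by rewrite divr_ge0// ltW.
have S := eigen_ode_scale (s := 0) (T := L) (d := n%:~R) p1 (ltW c0) kL
  (phi_ab_ode p1 orb a0 b0).
have uE' t : 0 <= t <= L -> u t = c * phi_ab U a b (k%:R / L * t + n%:~R).
  by move=> tI; rewrite uE// mulrAC.
split.
  apply: (eigen_ode_weak p1 a0 b0 L0 uE' S).
    by rewrite mulr0 add0r phi_ab_int mulr0.
  by rewrite divfK// (_ : k%:R + n%:~R = (k%:Z + n)%:~R) ?phi_ab_int ?mulr0// intrD.
have k1 : 1 <= k%:R :> R by rewrite ler1n.
(* This point is sent to [1/2 + n], halfway between two zeros of the wave. *)
exists (L / (2 * k%:R)); have tI : 0 <= L / (2 * k%:R) <= L.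
  apply/andP; split; first by rewrite divr_ge0 ?mulr_ge0 ?(ltW L0).
  by rewrite ler_pdivrMr ?mulr_gt0 ?ltr0n// ler_peMr ?(ltW L0)//; lra.
split => //; rewrite uE// mulf_neq0 ?(gt_eqF c0)//; apply/eqP.
have -> : k%:R * (L / (2 * k%:R)) / L = 1 / 2 by field; rewrite Ln kn.
move/(phi_ab_eq0 orb _ a0 b0) => [m em].
have : (2 * (m - n))%:~R = 1%:~R :> R by rewrite intrM intrB -em; lra.
by move/intr_inj; case: (m - n) => [[|[|j]]|[|j]].
Qed.

(** A real speed [k] matches the eigenvalue and [c] matches the initial flux, so uniqueness
    identifies [u] with a scaled wave; then [u L = 0] makes [k * L] an integer. The translate [n] is
    one whose flux has the sign of [w 0]. *)
Lemma eigen_ode_wave (n : int) lam' u w : 0 < lam' ->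
  eigen_ode p a b lam' 0 L u w -> u 0 = 0 -> u L = 0 ->
  0 < w 0 / phi_ab_flux p W a b n%:~R ->
  exists2 k : nat, (0 < k)%N /\ lam' = (k%:R / L) `^ p * Lam &
    exists2 c, 0 < c & forall t, 0 <= t <= L ->
      u t = c * phi_ab U a b (k%:R * t / L + n%:~R).
Proof.
move=> l0 S u0 uL; set z := phi_ab_flux p W a b n%:~R => wz.
have z0 : z != 0 by apply: contraTneq wz => ->; rewrite invr0 mulr0 ltxx.
have p0 : p != 0 by rewrite gt_eqF// (lt_trans ltr01 p1).
pose k := (lam' / Lam) `^ p^-1.
have k0 : 0 < k by rewrite powR_gt0// divr_gt0.
have kp : k `^ p * Lam = lam'.
  by rewrite /k -powRrM mulVf// powRr1 ?divr_ge0 ?(ltW l0) ?(ltW Lam_gt0)// divfK// gt_eqF.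
pose c := (w 0 / z) `^ (p - 1)^-1 / k.
have c0 : 0 < c by rewrite divr_gt0// powR_gt0.
have ck : (c * k) `^ (p - 1) * z = w 0.
  rewrite /c divfK ?gt_eqF// -powRrM mulVf ?powRr1 ?(ltW wz)// ?divfK//.
  by rewrite subr_eq0 gt_eqF.
have Sk := eigen_ode_scale (s := 0) (T := L) (d := n%:~R) p1 (ltW c0) (ltW k0)
  (phi_ab_ode p1 orb a0 b0).
rewrite -/Lam kp in Sk.
have eu : u 0 = c * phi_ab U a b (k * 0 + n%:~R).
  by rewrite mulr0 add0r phi_ab_int mulr0.
have ew : w 0 = (c * k) `^ (p - 1) * phi_ab_flux p W a b (k * 0 + n%:~R).
  by rewrite mulr0 add0r -ck.
have uE t : 0 <= t <= L -> u t = c * phi_ab U a b (k * t + n%:~R).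
  by move=> tI; have [] := eigen_ode_unique p1 a0 b0 l0 S Sk eu ew tI.
have := uE L; rewrite uL (ltW L0) lexx => /(_ isT)/esym/eqP.
rewrite mulf_eq0 (gt_eqF c0)/= => /eqP /(phi_ab_eq0 orb _ a0 b0)[m em].
have kL : k * L = (m - n)%:~R by rewrite intrB -em addrK.
have kL0 : 0 < k * L by rewrite mulr_gt0.
case: (m - n) kL => j kL; last first.
  by move: kL0; rewrite kL ltNge NegzE lerz0 lerNl oppr0.
have j0 : (0 < j)%N by move: kL0; rewrite kL ltr0n.
have kE : k = j%:R / L by rewrite -[j%:R]kL mulfK// gt_eqF.
exists j; first by split=> //; rewrite -kE kp.
exists c => // t tI; rewrite uE//; congr (_ * phi_ab _ _ _ (_ + _)).
by rewrite kE mulrAC.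
Qed.

Lemma eigenfunction_wave lam' u : eigenfunction_ab p a b L lam' u ->
  exists2 k : nat, (0 < k)%N /\ lam' = (k%:R / L) `^ p * Lam &
    exists c, 0 < c /\
      ((forall t, 0 <= t <= L -> u t = c * phi_ab U a b (k%:R * t / L)) \/
       (forall t, 0 <= t <= L -> u t = c * phi_ab U a b (k%:R * t / L - 1))).
Proof.
move=> [/(weak_eigen_ode p1 a0 b0 L0) [v [w [uv S v0 vL]]] [t1 [t1I ut1]]].
have l0 : 0 < lam'.
  rewrite ltNge; apply/negP => l0; move: ut1.
  by rewrite uv// (eigen_ode_nonpos p1 a0 b0 (ltW L0) l0 S v0 vL t1I) eqxx.
have [w0|w0|w0] := ltgtP 0 (w 0).
- have [|k hk [c c0 H]] := eigen_ode_wave (n := 0) l0 S v0 vL.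
    by rewrite divr_gt0// (phi_ab_flux0_gt0 orb).
  exists k => //; exists c; split => //; left => t tI.
  by rewrite uv// H// addr0.
- have [|k hk [c c0 H]] := eigen_ode_wave (n := -1) l0 S v0 vL.
    by rewrite -mulrNN -invrN mulr_gt0 ?invr_gt0 ?oppr_gt0// (phi_ab_fluxN1_lt0 orb).
  exists k => //; exists c; split => //; right => t tI.
  by rewrite uv// H.
(* Zero initial flux means starting at the equilibrium, which nontriviality excludes. *)
- have S0 : eigen_ode p a b lam' 0 L (fun=> 0) (fun=> 0) by exact: eigen_ode_zero.
  have [e _] := eigen_ode_unique p1 a0 b0 l0 S S0 v0 (esym w0) t1I.
  by move: ut1; rewrite uv// e eqxx.
Qed.

End Orbit.

Lemma principal_eigenfunction_orbit p (phi : R -> R) : 1 < p ->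
  principal_eigenfunction_p p phi ->
  exists U W, principal_orbit p (lambda_kp p 1 1) U W /\
    forall t, 0 <= t <= 1 -> phi t = U t.
Proof.
move=> p1 [weak pos _].
have e : flux_p p = flux_ab p 1 1 by apply/funext => x; exact: flux_pE.
move: weak; rewrite e => /(weak_eigen_ode p1 ltr01 ltr01 ltr01)[U [W [eU S U0 U1]]].
exists U, W; split => //; apply: principal_orbit_intro => // t /andP[h1 h2].
by rewrite -eU ?pos ?h1// (ltW h1) (ltW h2).
Qed.

End Spectrum.

Theorem theorem2 (R : realType) (p a b L : R) (phip : R -> R) :
  1 < p -> 0 < a -> 0 < b -> 0 < L ->
  principal_eigenfunction_p p phip ->
  (spectrum_ab p a b L = [set lam | exists k : nat, (0 < k)%N /\ lam = lambda_ab_kp p a b k L]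
   /\ [set lam | exists k : nat, (0 < k)%N /\ lam = lambda_ab_kp p a b k L]
      = [set lam | exists k : nat, (0 < k)%N /\ lam = ((a + b) / 2) `^ p * lambda_kp p k L])
  /\
  (forall (k : nat) (u : R -> R), (0 < k)%N ->
     (eigenfunction_ab p a b L (lambda_ab_kp p a b k L) u <->
      exists c : R, 0 < c /\
        ((forall t, 0 <= t <= L -> u t = c * phi_ab phip a b (k%:R * t / L))
         \/ (forall t, 0 <= t <= L -> u t = c * phi_ab phip a b (k%:R * t / L - 1))))).
Proof.
move=> p1 a0 b0 L0 principal.
have [U [W [orb eU]]] := principal_eigenfunction_orbit p1 principal.
have ext t : phi_ab phip a b t = phi_ab U a b t by exact: phi_ab_ext.
have wave k n c u (k0 : (0 < k)%N) (c0 : 0 < c) :=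
  wave_eigenfunction p1 a0 b0 L0 orb (n := n) k0 c0 (u := u).
split; [split|]; last 1 first.
- move=> k u k0; rewrite lambda_ab_kpE//; split.
    move=> /(eigenfunction_wave p1 a0 b0 L0 orb)[k' [k'0 e] [c [c0 H]]].
    (* Equal eigenvalues give equal indices, since [x^p] is injective on nonnegative reals. *)
    have kk : k = k'.
      have Lam0 : ((a + b) / 2) `^ p * lambda_kp p 1 1 != 0.
        by rewrite gt_eqF// mulr_gt0 ?(orbit_lam orb)// powR_gt0// divr_gt0// addr_gt0.
      have pp : 0 < p by lra.
      move: e => /(mulIf Lam0)/(powR_injective pp).
      rewrite !nnegrE !divr_ge0 ?(ltW L0)// => /(_ isT isT).
      have Li : L^-1 != 0 by rewrite invr_eq0 gt_eqF.
      by move=> /(mulIf Li)/eqP; rewrite eqr_nat => /eqP.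
    exists c; split => //; rewrite kk.
    by case: H => H; [left|right] => t tI; rewrite ext H.
  move=> [c [c0 [H|H]]].
    by apply: (wave k 0 c) => // t tI; rewrite addr0 H// ext.
  by apply: (wave k (-1) c) => // t tI; rewrite H// ext.
- apply/seteqP; split => lam /=.
    move=> [u /(eigenfunction_wave p1 a0 b0 L0 orb)[k [k0 e] _]].
    by exists k; split => //; rewrite lambda_ab_kpE.
  move=> [k [k0 ->]]; rewrite lambda_ab_kpE//.
  exists (fun t => 1 * phi_ab U a b (k%:R * t / L + 0%:~R)).
  exact: (wave k 0 1).
- apply/seteqP; split => lam /= [k [k0 ->]]; exists k; split => //;
    by rewrite lambda_ab_kpE// (lambda_kpE p k L0); ring.
Qed.
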